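(* Let $F$ be a continuous distribution function of a positive random variable with finite mean $\overline{\tau}$, and let $M_{eq}$ be its equilibrium mean square displacement (with velocity second moment $v^2$). Suppose $1-F(t)=G(t)+H(t)$ for $t>0$, where $G$ and $H$ are integrable functions on $(0,\infty)$ with $\int_0^\infty|H(t)|\,t\,dt<\infty$. Then, as $t\to\infty$, $$M_{eq}(t)=\frac{v^2}{\overline{\tau}}\left(t^2\int_t^\infty G(u)\,du+\int_0^tG(u)(2tu-u^2)\,du\right)+O(t).$$
   Context: Equilibrium mean square displacement associated with $F$, $\overline{\tau}=\int_0^\infty(1-F(s))\,ds$: let $\tau_1,\tau_2,\dots$ be i.i.d. with distribution $F$, let $T_0$ be independent of the $\tau_i$ with distribution function $F_0(t)=\frac1{\overline{\tau}}\int_0^t(1-F(s))\,ds$, and $T_i=T_{i-1}+\tau_i$. Let $V_0,V_1,\dots$ be i.i.d. random vectors in $\mathbb{R}^d$, independent of the times, with $E[V_i]=0$ and $E[|V_i|^2]=v^2\in(0,\infty)$. Set $V(t)=V_0$ for $0\le t<T_0$, $V(t)=V_i$ for $T_{i-1}\le t<T_i$, $X(t)=\int_0^tV(s)\,ds$, and $M_{eq}(t)=E[|X(t)|^2]$. *)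

(* Defs.v *)
From HB Require Import structures.
From mathcomp Require Import all_boot all_order all_algebra.
From mathcomp Require Import all_classical all_reals all_analysis.
Set Implicit Arguments. Unset Strict Implicit. Unset Printing Implicit Defensive.
Import Order.TTheory GRing.Theory Num.Theory.
Local Open Scope classical_set_scope.
Local Open Scope ring_scope.

Section defs.
Context {dT : measure_display} {T : measurableType dT} {R : realType}.

Definition gen_events {dU} {U : measurableType dU} (X : T -> U) : set (set T) :=
  [set X @^-1` B | B in [set B : set U | measurable B]].

Definition mutually_independent {I : eqType} (P : probability T R)
  (E : I -> set (set T)) : Prop :=
  forall (J : seq I), uniq J -> forall A : I -> set T,
    (forall i, i \in J -> E i (A i)) ->
    P (\big[setI/setT]_(i <- J) A i) = (\prod_(i <- J) P (A i))%E.

(* renewal times: Tn 0 = T_0, Tn (i+1) = T_(i+1) = T_i + tau_(i+1),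
   where tau i : T -> R stands for the paper's tau_(i+1) *)
Fixpoint Tn (T0 : T -> R) (tau : nat -> T -> R) (i : nat) (w : T) : R :=
  match i with
  | 0 => T0 w
  | i'.+1 => Tn T0 tau i' w + tau i' w
  end.

(* velocity at time s: V_i where i is the least index with s < T_i,
   i.e. V_0 on [0,T_0) and V_i on [T_(i-1), T_i); 0 if no such i *)
Definition Vel (d : nat) (T0 : T -> R) (tau : nat -> T -> R)
  (V : nat -> T -> d.-tuple R) (s : R) (w : T) : d.-tuple R :=
  match pselect (exists i, (fun i => s < Tn T0 tau i w) i) with
  | left h => V (ex_minn h) w
  | right _ => [tuple of nseq d 0]
  end.

Definition Xpos (d : nat) (T0 : T -> R) (tau : nat -> T -> R)
  (V : nat -> T -> d.-tuple R) (t : R) (j : 'I_d) (w : T) : R :=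
  Rintegral (@lebesgue_measure R) `[0, t]
    (fun s => tnth (Vel T0 tau V s w) j).

Definition msd (P : probability T R) (d : nat) (T0 : T -> R)
  (tau : nat -> T -> R) (V : nat -> T -> d.-tuple R) (t : R) : \bar R :=
  \int[P]_w (\sum_(j < d) (Xpos T0 tau V t j w) ^+ 2)%:E.

End defs.

(* index set of the family (T_0, tau_1, tau_2, ..., V_0, V_1, ...) *)
Definition eq_index := option (nat + nat)%type.

(* Main.v *)
Require Import Defs.
From HB Require Import structures.
From mathcomp Require Import all_boot all_order all_algebra.
From mathcomp Require Import all_classical all_reals all_analysis.
From mathcomp Require Import measurable_realfun ring lra.
Import Order.TTheory GRing.Theory Num.Theory numFieldNormedType.Exports.
Local Open Scope classical_set_scope.
Local Open Scope ring_scope.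
Set Implicit Arguments.
Unset Strict Implicit.
Unset Printing Implicit Defensive.

(** Conditionally on the renewal times, the displacement is a sum of centred
    independent vectors, so its mean square is [v2] times the expectation of the
    sum of the squared lengths of the renewal intervals cut at [t].

    The equilibrium law of [T_0] makes the renewal function linear. With
    [S_n = tau_1 + ... + tau_n], Tonelli's theorem gives
    [taubar * P(T_n <= y) = E min((y - S_n)^+, tau_(n+1))
       = E (y - S_n)^+ - E (y - S_(n+1))^+],
    and this telescopes to [sum_n P(T_n <= y) = y / taubar]. The layer cake
    formula then yields the exact identity
    [M_eq(t) = v2 / taubar * int_0^oo (1 - F(s)) k_t(s) ds], where
    [k_t(s) = 2 t s - s^2] for [s <= t] and [k_t(s) = t^2] for [s > t]. The
    [G]-part of this integral is the main term, and [0 <= k_t(s) <= 2 t s]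
    bounds the [H]-part by a multiple of [t]. *)

(** * Independence *)

Section independence.
Context d (T : measurableType d) (R : realType) (P : probability T R).
Local Open Scope ereal_scope.

Definition indep_rv d1 d2 (U : measurableType d1) (W : measurableType d2)
    (X : T -> U) (Y : T -> W) :=
  forall B C, measurable B -> measurable C ->
    P (X @^-1` B `&` Y @^-1` C) = P (X @^-1` B) * P (Y @^-1` C).

Lemma ge0_integral_indep_rv d1 d2 (U : measurableType d1)
    (W : measurableType d2) (X : T -> U) (Y : T -> W) (f : U * W -> \bar R) :
  measurable_fun setT X -> measurable_fun setT Y -> indep_rv X Y ->
  measurable_fun setT f -> (forall z, 0 <= f z) ->
  \int[P]_w f (X w, Y w) = \int[P]_w \int[P]_w' f (X w, Y w').
Proof.
move=> mX mY XY mf f0.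
have mZ : measurable_fun setT (fun w => (X w, Y w)) by exact: measurable_fun_pair.
pose X' : {mfun T >-> U} := HB.pack X (isMeasurableFun.Build _ _ _ _ _ mX).
pose Y' : {mfun T >-> W} := HB.pack Y (isMeasurableFun.Build _ _ _ _ _ mY).
pose Z' : {mfun T >-> (U * W)%type} :=
  HB.pack (fun w => (X w, Y w)) (isMeasurableFun.Build _ _ _ _ _ mZ).
transitivity (\int[distribution P Z']_z f z).
  by rewrite ge0_integral_distribution.
transitivity (\int[distribution P X' \x distribution P Y']_z f z).
  apply: eq_measure_integral => A mA _; apply/esym.
  exact: product_measure_unique.
rewrite fubini_tonelli1// ge0_integral_distribution.
- apply: eq_integral => w _ /=; rewrite /fubini_F ge0_integral_distribution//.
  exact: measurable_fun_pair2.
- exact: measurable_fun_fubini_tonelli_F.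
- by move=> x; apply: integral_ge0.
Qed.

Lemma indep_rv_integrableM (X Y : T -> R) :
  indep_rv X Y -> P.-integrable setT (EFin \o X) ->
  P.-integrable setT (EFin \o Y) ->
  P.-integrable setT (fun w => (X w * Y w)%:E).
Proof.
move=> XY iX iY.
have mX : measurable_fun setT X by apply/measurable_EFinP; apply: measurable_int iX.
have mY : measurable_fun setT Y by apply/measurable_EFinP; apply: measurable_int iY.
apply/integrableP; split.
  by apply/measurable_EFinP; exact: measurable_funM.
rewrite (@ge0_integral_indep_rv _ _ _ _ X Y (fun z : R * R => `|(z.1 * z.2)%:E|))//;
  last first.
  apply: measurableT_comp => //; apply/measurable_EFinP.
  by apply: measurable_funM; [exact: measurable_fst|exact: measurable_snd].
have [/integrableP[_ hX] /integrableP[_ hY]] := (iX, iY).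
have hYf : \int[P]_w `|(EFin \o Y) w| \is a fin_num.
  by rewrite ge0_fin_numE// integral_ge0.
rewrite (eq_integral (fun w => `|(X w)%:E| * \int[P]_w `|(EFin \o Y) w|)); last first.
  move=> w _; rewrite -ge0_integralZl//; last first.
    by apply: measurableT_comp => //; exact/measurable_EFinP.
  by apply: eq_integral => w' _; rewrite EFinM abseM.
rewrite -(fineK hYf) ge0_integralZr//.
- by rewrite fineK// lte_mul_pinfty// ?integral_ge0// ge0_fin_numE ?integral_ge0.
- by apply: measurableT_comp => //; exact/measurable_EFinP.
- by rewrite fineK// integral_ge0.
Qed.

Lemma indep_rv_integralM (X Y : T -> R) :
  indep_rv X Y -> P.-integrable setT (EFin \o X) ->
  P.-integrable setT (EFin \o Y) ->
  \int[P]_w (X w * Y w)%:E = (\int[P]_w (X w)%:E) * (\int[P]_w (Y w)%:E).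
Proof.
move=> XY iX iY.
have mX : measurable_fun setT X by apply/measurable_EFinP; apply: measurable_int iX.
have mY : measurable_fun setT Y by apply/measurable_EFinP; apply: measurable_int iY.
have iXY := indep_rv_integrableM XY iX iY.
pose f (z : R * R) : \bar R := (z.1 * z.2)%:E.
have mf : measurable_fun setT f.
  apply/measurable_EFinP.
  by apply: measurable_funM; [exact: measurable_fst|exact: measurable_snd].
have mZ : measurable_fun setT (fun w => (X w, Y w)) by exact: measurable_fun_pair.
pose X' : {mfun T >-> R} := HB.pack X (isMeasurableFun.Build _ _ _ _ _ mX).
pose Y' : {mfun T >-> R} := HB.pack Y (isMeasurableFun.Build _ _ _ _ _ mY).
pose Z' : {mfun T >-> (R * R)%type} :=
  HB.pack (fun w => (X w, Y w)) (isMeasurableFun.Build _ _ _ _ _ mZ).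
have ZE A : measurable A ->
    distribution P Z' A = (distribution P X' \x distribution P Y') A.
  move=> mA; apply/esym; exact: product_measure_unique.
have iZ : (distribution P Z').-integrable setT f.
  by apply: integrable_pushforward.
have iprod : (distribution P X' \x distribution P Y').-integrable setT f.
  apply/integrableP; split => //.
  rewrite (@eq_measure_integral _ _ _ _ (distribution P Z')).
    by case/integrableP : iZ.
  by move=> A mA _; exact/esym/ZE.
transitivity (\int[distribution P Z']_z f z).
  by rewrite integral_distribution.
transitivity (\int[distribution P X' \x distribution P Y']_z f z).
  by apply: eq_measure_integral => A mA _; exact: ZE.
have iY' : (distribution P Y').-integrable setT EFin.
  exact: integrable_pushforward.
have iX' : (distribution P X').-integrable setT EFin.
  exact: integrable_pushforward.
have EX : \int[P]_w (X w)%:E = \int[distribution P X']_x x%:E.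
  by rewrite integral_distribution.
have EY : \int[P]_w (Y w)%:E = \int[distribution P Y']_x x%:E.
  by rewrite integral_distribution.
rewrite -integral12_prod_meas1// EX EY.
rewrite (eq_integral (fun x : R => x%:E * \int[distribution P Y']_y y%:E)); last first.
  by move=> x _; rewrite /fubini_F -integralZl.
have /fineK <- := integrable_fin_num measurableT iY'.
by rewrite integralZr.
Qed.

Section others.
Context (I : choiceType) (E : I -> set (set T)).
Hypothesis mE : forall i A, E i A -> measurable A.
Hypothesis ET : forall i, E i setT.
Hypothesis EI : forall i, setI_closed (E i).

(* The pi-system generating the sigma-algebra of all members of the family but
   the [k]-th. *)
Definition others (k : I) : set (set T) := [set B | exists (J : seq I) (A : I -> set T),
  [/\ uniq J, k \notin J, forall i, E i (A i) & B = \big[setI/setT]_(i <- J) A i]].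

Lemma othersT k : others k setT.
Proof. by exists [::], (fun=> setT); split => //; rewrite big_nil. Qed.

Lemma others_measurable k : others k `<=` measurable.
Proof.
move=> _ [J [A [_ _ EA ->]]]; apply: bigsetI_measurable => i _.
exact/mE/EA.
Qed.

Lemma others_sub k i A : i != k -> E i A -> others k A.
Proof.
move=> ik EA; exists [:: i], (fun j => if j == i then A else setT); split => //.
- by rewrite inE eq_sym.
- by move=> j; case: eqP => [->//|_]; exact: ET.
- by rewrite big_seq1 eqxx.
Qed.

Lemma others_setI k : setI_closed (others k).
Proof.
move=> _ _ [J [A [uJ kJ EA ->]]] [J' [A' [uJ' kJ' EA' ->]]].
pose A1 i := if i \in J then A i else setT.
pose A2 i := if i \in J' then A' i else setT.
exists (undup (J ++ J')), (fun i => A1 i `&` A2 i); split.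
- exact: undup_uniq.
- by rewrite mem_undup mem_cat negb_or kJ.
- by move=> i; apply: EI; [rewrite /A1|rewrite /A2]; case: ifP.
- rewrite -!bigcap_seq; apply/seteqP; split => w /=.
    move=> [h h'] i /=; rewrite mem_undup mem_cat => iJ; split.
      by rewrite /A1; case: ifPn => // iJ1; exact: h.
    by rewrite /A2; case: ifPn => // iJ1; exact: h'.
  move=> h; split => i /= iJ.
    by have := h i; rewrite /= mem_undup mem_cat iJ => /(_ isT)[]; rewrite /A1 iJ.
  by have := h i; rewrite /= mem_undup mem_cat iJ orbT => /(_ isT)[_]; rewrite /A2 iJ.
Qed.

Hypothesis indep : mutually_independent P E.

Lemma others_indep k A B : <<s others k >> A -> E k B -> P (A `&` B) = P A * P B.
Proof.
move=> sA EB; have mB := mE EB.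
have fB : P B \is a fin_num by exact: fin_num_measure.
have B0 : (0 <= fine (P B))%R by exact: fine_ge0.
have := @g_sigma_algebra_measure_unique _ _ _ (others k) (@others_measurable k)
  (fun=> setT) (fun=> othersT k) _ (mrestr P mB)
  (mscale (NngNum B0) P) (@others_setI k) _ _ A sA.
have mscE A' : mscale (NngNum B0) P A' = P B * P A' by rewrite /mscale/= fineK.
move=> uniqm; rewrite muleC -mscE; apply: uniqm.
- by rewrite bigcup_const//; exists 0%N.
- move=> _ [J [A' [uJ kJ EA' ->]]]; rewrite /= mscE /mrestr.
  pose A2 i := if i == k then B else A' i.
  have A2E i : i \in J -> A2 i = A' i.
    by rewrite /A2; case: eqP => // -> kJ'; rewrite kJ' in kJ.
  have := @indep (k :: J) _ A2; rewrite /= kJ uJ => /(_ isT).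
  have EA2 i : E i (A2 i) by rewrite /A2; case: eqP => [->|].
  have AE : \big[setI/setT]_(i <- J) A' i = \big[setI/setT]_(i <- J) A2 i.
    by rewrite big_seq [RHS]big_seq; apply: eq_bigr => i /A2E.
  have BE : B = A2 k by rewrite /A2 eqxx.
  rewrite !big_cons AE BE setIC => -> //.
  by rewrite (@indep J).
- move=> _; change (P (setT `&` B) < +oo).
  by rewrite setTI ltey_eq fB.
Qed.

Lemma others_indep_rv k d1 d2 (U : measurableType d1) (W : measurableType d2)
    (X : T -> U) (Y : T -> W) :
  measurable_fun setT (X : g_sigma_algebraType (others k) -> U) ->
  (forall C, measurable C -> E k (Y @^-1` C)) -> indep_rv X Y.
Proof.
move=> mX EY B C mB mC; apply: others_indep; last exact: EY.
by have := mX measurableT _ mB; rewrite setTI.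
Qed.

Lemma others_measurable_fun k d1 (U : measurableType d1) (X : T -> U) :
  measurable_fun setT (X : g_sigma_algebraType (others k) -> U) ->
  measurable_fun setT X.
Proof.
move=> mX _ B mB; have := mX measurableT _ mB.
by apply: smallest_sub; [exact: sigma_algebra_measurable|exact: others_measurable].
Qed.

Lemma measurable_fun_others k i d1 (U : measurableType d1) (X : T -> U) :
  i != k -> (forall C, measurable C -> E i (X @^-1` C)) ->
  measurable_fun setT (X : g_sigma_algebraType (others k) -> U).
Proof.
move=> ik EX _ B mB; rewrite setTI; apply: sub_sigma_algebra.
by apply: (others_sub ik); exact: EX.
Qed.

End others.

End independence.

(** * Null sets and layer cake integrals *)

Section null_sets.
Context d (T : measurableType d) (R : realType) (mu : {measure set T -> \bar R}).
Local Open Scope ereal_scope.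
Import HBNNSimple.

Let ge0_null_le_integral (N : set T) (f g : T -> \bar R) :
  measurable N -> mu N = 0 -> (forall x, 0 <= f x) -> (forall x, 0 <= g x) ->
  (forall x, ~ N x -> f x = g x) -> \int[mu]_x f x <= \int[mu]_x g x.
Proof.
move=> mN N0 f0 g0 fg; rewrite (ge0_integralTE _ f0) (ge0_integralTE _ g0).
apply: ub_ereal_sup => _ [h /= hf <-].
have mNC : measurable (~` N) by exact: measurableC.
apply: ereal_sup_ubound => /=; exists (proj_nnsfun h mNC) => /=.
  move=> x; rewrite mindicE; have [Nx|Nx] := pselect (N x).
    by rewrite memNset ?mulr0//; exact.
  by rewrite mem_set// mulr1 -fg.
rewrite -!integralT_nnsfun; apply: ge0_ae_eq_integral => //.
- exact/measurable_EFinP.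
- exact/measurable_EFinP.
- by move=> x _; rewrite lee_fin.
- by move=> x _; rewrite lee_fin.
- exists N; split => // x /= /not_implyP[_]; apply: contra_notP => Nx.
  by rewrite mindicE mem_set// mulr1.
Qed.

(* Neither function is assumed measurable. *)
Lemma ge0_null_eq_integral (N : set T) (f g : T -> \bar R) :
  measurable N -> mu N = 0 -> (forall x, 0 <= f x) -> (forall x, 0 <= g x) ->
  (forall x, ~ N x -> f x = g x) -> \int[mu]_x f x = \int[mu]_x g x.
Proof.
move=> mN N0 f0 g0 fg; apply/eqP; rewrite eq_le.
by apply/andP; split; apply: ge0_null_le_integral mN N0 _ _ _ => // x /fg.
Qed.

End null_sets.

Section layer_cake.
Context (R : realType).
Local Notation lam := (@lebesgue_measure R).

Definition cap (a b u : R) : R := [&& 0 <= u, u <= a & u < b]%:R.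

Lemma integral_cap (f : R -> R) (a b : R) : measurable_fun setT f -> 0 <= b ->
  (\int[lam]_u (f u * cap a b u)%:E =
   \int[lam]_(u in `[0%R, Num.min (Num.max a 0%R) b]) (f u)%:E)%E.
Proof.
move=> mf b0; have [a0|a0] := ltP a 0.
  rewrite (min_idPl _) ?(max_idPr (ltW a0))// set_itv1 integral_set1.
  apply: integral0_eq => u _; rewrite /cap.
  by case: (leP 0 u) => u0; rewrite ?mulr0// leNgt (lt_le_trans a0 u0) mulr0.
have [ba|ab] := leP b a.
  rewrite -integral_itv_bndo_bndc; last first.
    by apply/measurable_EFinP; exact: measurable_funTS.
  rewrite [RHS]integral_mkcond; apply: eq_integral => u _.
  rewrite /patch mem_setE in_itv/= /cap.
  case: (ltP u b) => ub; rewrite ?andbF ?mulr0// (le_trans (ltW ub) ba) !andbT.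
  by case: leP; rewrite ?mulr0 ?mulr1.
rewrite [RHS]integral_mkcond; apply: eq_integral => u _.
rewrite /patch mem_setE in_itv/= /cap.
case: (leP u a) => ua; rewrite ?andbF ?mulr0// (le_lt_trans ua ab) !andbT.
by case: leP; rewrite ?mulr0 ?mulr1.
Qed.

Lemma integral_cap_cst (a b : R) : 0 <= b ->
  (\int[lam]_u (cap a b u)%:E = (Num.min (Num.max a 0) b)%R%:E)%E.
Proof.
move=> b0; under eq_integral do rewrite -[cap _ _ _]mul1r.
have c0 : 0 <= Num.min (Num.max a 0) b by rewrite le_min le_max lexx orbT.
rewrite (@integral_cap (cst 1))// (integral_cst _ _ 1%E)//.
rewrite mul1e [LHS]lebesgue_measure_itv/=.
rewrite lte_fin; case: ltP => [_|c0']; first by rewrite -EFinB subr0.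
by congr EFin; apply/eqP; rewrite eq_le c0.
Qed.

Lemma integral_itv_2id (c : R) : 0 <= c ->
  (\int[lam]_(u in `[0%R, c]) (2 * u)%:E = (c ^+ 2)%:E)%E.
Proof.
rewrite le_eqVlt => /predU1P[<-|c0].
  by rewrite set_itv1 integral_set1 expr0n.
rewrite (@continuous_FTC2 _ _ (fun x : R => x ^+ 2))//.
- by rewrite expr0n/= sube0.
- apply: continuous_subspaceT => x.
  by apply: cvgM; [exact: cvg_cst|exact: cvg_id].
- split.
  + by move=> x _; exact: exprn_derivable.
  + by apply: cvg_at_right_filter; exact: exprn_continuous.
  + by apply: cvg_at_left_filter; exact: exprn_continuous.
- move=> x _; rewrite derive1E exp_derive.
  by rewrite expr1 /GRing.scale/= mulr1 mulr_natl.
Qed.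

Lemma integral_cap_2id (a b : R) : 0 <= b ->
  (\int[lam]_u (2 * u * cap a b u)%:E = (Num.min (Num.max a 0) b ^+ 2)%R%:E)%E.
Proof.
move=> b0; rewrite (@integral_cap (fun u => 2 * u))//; last first.
  by apply: measurable_funM => //.
by rewrite integral_itv_2id// le_min le_max lexx orbT.
Qed.

End layer_cake.

Section tonelli_bool.
Context d (T : measurableType d) (R : realType) (P : probability T R).
Local Notation lam := (@lebesgue_measure R).
Local Open Scope ereal_scope.

Lemma measurable_bool d' (U : measurableType d') (b : U -> bool) :
  measurable_fun setT b -> measurable [set w | b w].
Proof.
move=> mb; rewrite (_ : [set w | b w] = setT `&` b @^-1` [set true]).
  exact: mb.
by rewrite setTI; apply/seteqP; split.
Qed.

Lemma measurable_fun_natr d' (U : measurableType d') (b : U -> bool) :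
  measurable_fun setT b ->
  measurable_fun setT (fun w => (b w)%:R : R).
Proof.
have mn : measurable_fun setT (fun c : bool => c%:R : R) by [].
exact: measurableT_comp mn.
Qed.

Lemma integral_bool (b : T -> bool) (mu : {measure set T -> \bar R}) :
  measurable_fun setT b -> \int[mu]_w (b w)%:R%:E = mu [set w | b w].
Proof.
move=> mb; rewrite -[X in _ = mu X]setIT -integral_indic//; last exact: measurable_bool.
apply: eq_integral => w _; rewrite indicE; congr (_%:R%:E).
by case bw : (b w); [rewrite mem_set|rewrite memNset//= bw].
Qed.

Lemma integral_tonelli_bool (b : T * R -> bool) (f : R -> R) :
  measurable_fun setT b -> measurable_fun setT f ->
  (forall z, b z -> (0 <= f z.2)%R) ->
  \int[P]_w \int[lam]_u (f u * (b (w, u))%:R)%:E =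
  \int[lam]_u ((f u)%:E * P [set w | b (w, u)]).
Proof.
move=> mb mf f0.
have mb1 : measurable_fun setT (fun z : T * R => ((b z)%:R : R)).
  exact: measurable_fun_natr.
have fb0 z : (0 <= f z.2 * (b z)%:R)%R.
  by case: (boolP (b z)) => [/f0 ?|_]; rewrite ?mulr0// mulr1.
rewrite (@fubini_tonelli _ _ _ _ _ P lam (fun z => (f z.2 * (b z)%:R)%:E))//=; last first.
  apply/measurable_EFinP; apply: measurable_funM => //.
  exact: measurableT_comp mf measurable_snd.
apply: eq_integral => u _.
have mbu : measurable_fun setT (fun w => b (w, u)) by exact: measurable_fun_pair1.
have [fu0|fu0] := leP 0%R (f u).
  rewrite -integral_bool// -ge0_integralZl//.
  apply/measurable_EFinP; exact: measurable_fun_natr.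
rewrite (_ : [set _ | _] = set0) ?measure0 ?mule0; last first.
  by apply/seteqP; split => // w /= /f0/=; rewrite leNgt fu0.
apply: integral0_eq => w _; case: (boolP (b (w, u))) => [/f0/=|_]; last by rewrite mulr0.
by rewrite leNgt fu0.
Qed.

End tonelli_bool.

(** * The equilibrium renewal process *)

Lemma exists_prob_le_gt0 d (T : measurableType d) (R : realType) (P : probability T R)
  (X : T -> R) : measurable_fun setT X ->
  exists n : nat, (0 < P [set w | X w <= n%:R]%R)%E.
Proof.
move=> mX; apply/not_existsP => P0.
pose A (n : nat) : set T := [set w | X w <= n%:R].
have mA n : measurable (A n) by apply: measurable_bool; exact: measurable_fun_ler.
have UA : \bigcup_n A n = setT.
  apply/seteqP; split => // w _; exists (Num.truncn `|X w|).+1 => //=.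
  by rewrite /A/= (le_trans (ler_norm _))// ltW// truncnS_gt.
have PA n : P (A n) = 0%E.
  by apply/eqP; rewrite eq_le measure_ge0 andbT leNgt; apply/negP; exact: P0.
have ndA : nondecreasing_seq A.
  move=> m n mn; apply/subsetPset => w /= h.
  by rewrite /A/= (le_trans h)// ler_nat.
have : P (A n) @[n --> \oo] --> P setT.
  by rewrite -UA; apply: nondecreasing_cvg_mu => //; exact: bigcupT_measurable.
rewrite probability_setT (_ : (fun n => P (A n)) = cst 0%E); last exact/funext.
move/cvg_lim => /(_ (@ereal_hausdorff R)); rewrite lim_cst//.
by move/eqP; rewrite eq_sym onee_eq0.
Qed.

Section renewal.
Context d (T : measurableType d) (R : realType) (P : probability T R).
Context (F : R -> R) (taubar : R) (T0 : T -> R) (tau : nat -> T -> R).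
Local Notation lam := (@lebesgue_measure R).
Hypothesis mF : measurable_fun setT F.
Hypothesis taubar_gt0 : 0 < taubar.
Hypothesis mT0 : measurable_fun setT T0.
Hypothesis mtau : forall i, measurable_fun setT (tau i).
Hypothesis T0_ge0 : forall w, 0 <= T0 w.
Hypothesis tau_ge0 : forall i w, 0 <= tau i w.
Hypothesis tauF : forall i t, P (tau i @^-1` `]-oo, t]) = (F t)%:E.
Hypothesis T0F : forall t, P (T0 @^-1` `]-oo, t]) =
  ((taubar^-1)%:E * \int[lam]_(u in `[0%R, t]) (1 - F u)%:E)%E.

Definition rsum n w := \sum_(i < n) tau i w.

Hypothesis rsum_T0 : forall n, indep_rv P (rsum n) T0.
Hypothesis rsum_tau : forall n, indep_rv P (rsum n) (tau n).
Hypothesis Tn_tau : forall n, indep_rv P (Tn T0 tau n) (tau n).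

Lemma TnE n w : Tn T0 tau n w = T0 w + rsum n w.
Proof.
elim: n => [|n ih] /=; first by rewrite /rsum big_ord0 addr0.
by rewrite ih /rsum big_ord_recr/= addrA.
Qed.

Lemma measurable_rsum n : measurable_fun setT (rsum n).
Proof. by apply: measurable_sum => i; exact: mtau. Qed.

Lemma measurable_Tn n : measurable_fun setT (Tn T0 tau n).
Proof. by elim: n => [//|n ih] /=; exact: measurable_funD. Qed.

Lemma rsum_ge0 n w : 0 <= rsum n w.
Proof. exact: sumr_ge0. Qed.

Lemma rsumS n w : rsum n.+1 w = rsum n w + tau n w.
Proof. by rewrite /rsum big_ord_recr. Qed.

Lemma preim_le (X : T -> R) a : X @^-1` `]-oo, a] = [set w | X w <= a].
Proof. by apply/seteqP; split => w /=; rewrite in_itv. Qed.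

Lemma measurable_le (X : T -> R) a : measurable_fun setT X ->
  measurable [set w | X w <= a].
Proof.
by move=> mX; apply: measurable_bool; exact: measurable_fun_ler.
Qed.

Lemma tail_ge0 x : 0 <= 1 - F x.
Proof.
rewrite subr_ge0 -lee_fin -(tauF 0); apply: probability_le1.
by rewrite preim_le; exact: measurable_le.
Qed.

Lemma tau_gt n u : P [set w | u < tau n w] = (1 - F u)%:E.
Proof.
have -> : [set w | u < tau n w] = ~` (tau n @^-1` `]-oo, u]).
  by rewrite preim_le; apply/seteqP; split => w /=; rewrite ltNge => /negP.
by rewrite probability_setC ?tauF// preim_le; exact: measurable_le.
Qed.

Lemma cap_tau (X : T -> R) n a u : measurable_fun setT X -> indep_rv P X (tau n) ->
  P [set w | [&& 0 <= u, u <= a - X w & u < tau n w]] =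
  ((1 - F u)%:E * P [set w | (0 <= u)%R && (u <= a - X w)%R])%E.
Proof.
move=> mX iX; have [u0/=|u0/=] := leP 0 u; last first.
  have -> : [set w : T | false] = set0 by apply/seteqP; split.
  by rewrite measure0 mule0.
have XE : [set w | u <= a - X w] = X @^-1` `]-oo, a - u].
  by rewrite preim_le; apply/seteqP; split => w/=; rewrite lerBrDr addrC -lerBrDr.
rewrite -(tau_gt n) muleC XE.
have tE : [set w | u < tau n w] = tau n @^-1` `]u, +oo[.
  by apply/seteqP; split => w/=; rewrite in_itv/= andbT.
rewrite tE -iX//; congr (P _); rewrite -tE -XE.
by apply/seteqP; split => w /= => [/andP[]|[] ->].
Qed.

Let mcap (X : T -> R) n a : measurable_fun setT X ->
  measurable_fun setT (fun z : T * R => [&& 0 <= z.2, z.2 <= a - X z.1 & z.2 < tau n z.1]).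
Proof.
move=> mX; apply: measurable_and; last apply: measurable_and.
- by apply: measurable_fun_ler => //; exact: measurable_snd.
- apply: measurable_fun_ler; first exact: measurable_snd.
  apply: measurable_funB => //; exact: measurableT_comp mX measurable_fst.
- apply: measurable_fun_ltr; first exact: measurable_snd.
  exact: measurableT_comp (mtau n) measurable_fst.
Qed.

Let mcap1 (X : T -> R) a : measurable_fun setT X ->
  measurable_fun setT (fun z : T * R => (0 <= z.2) && (z.2 <= a - X z.1)).
Proof.
move=> mX; apply: measurable_and.
- by apply: measurable_fun_ler => //; exact: measurable_snd.
- apply: measurable_fun_ler; first exact: measurable_snd.
  apply: measurable_funB => //; exact: measurableT_comp mX measurable_fst.
Qed.

Lemma integral_min_tau (X : T -> R) n a : measurable_fun setT X ->
    indep_rv P X (tau n) ->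
  (\int[P]_w (Num.min (Num.max (a - X w) 0) (tau n w))%R%:E =
   \int[lam]_u ((1 - F u)%:E * P [set w | (0 <= u)%R && (u <= a - X w)%R]))%E.
Proof.
move=> mX iX; under eq_integral do rewrite -integral_cap_cst//.
transitivity (\int[P]_w \int[lam]_u (cst 1 u * cap (a - X w) (tau n w) u)%:E)%E.
  by apply: eq_integral => w _; apply: eq_integral => u _; rewrite mul1r.
rewrite (integral_tonelli_bool P (mcap n a mX))//.
by apply: eq_integral => u _; rewrite mul1e cap_tau.
Qed.

Lemma integral_min2_tau (X : T -> R) n a : measurable_fun setT X ->
    indep_rv P X (tau n) ->
  (\int[P]_w (Num.min (Num.max (a - X w) 0) (tau n w) ^+ 2)%R%:E =
   \int[lam]_u ((2 * u)%:E * ((1 - F u)%:E *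
     P [set w | (0 <= u)%R && (u <= a - X w)%R])))%E.
Proof.
move=> mX iX; under eq_integral do rewrite -integral_cap_2id//.
rewrite (@integral_tonelli_bool _ _ _ P _ (fun u => 2 * u) (mcap n a mX))//.
- by apply: eq_integral => u _; rewrite cap_tau.
- by apply: measurable_funM.
- by move=> z /andP[z0 _]; rewrite mulr_ge0.
Qed.

(* [T_0] and [tau n] are both independent of [rsum n], and the density of [T_0]
   at [u] is [P(u < tau n) / taubar]. *)
Lemma prob_Tn n y : (P [set w | Tn T0 tau n w <= y]%R = (taubar^-1)%:E *
  \int[P]_w (Num.min (Num.max (y - rsum n w) 0) (tau n w))%R%:E)%E.
Proof.
have mS := measurable_rsum n.
rewrite integral_min_tau//.
have mD : measurable_fun setT (fun u => 1 - F u) by exact: measurable_funB.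
rewrite -(integral_tonelli_bool P (mcap1 y mS))//; last first.
  by move=> z _; exact: tail_ge0.
pose f (z : T * R) := ((1 - F z.2) * ((0 <= z.2) && (z.2 <= y - rsum n z.1))%:R)%:E.
have mJ : measurable_fun setT (fubini_F lam f).
  apply: measurable_fun_fubini_tonelli_F.
    apply/measurable_EFinP; apply: measurable_funM.
      exact: measurableT_comp mD measurable_snd.
    by apply: measurable_fun_natr; exact: mcap1.
  by move=> z; rewrite lee_fin mulr_ge0// tail_ge0.
rewrite -ge0_integralZl//; last 2 first.
- by move=> w _; apply: integral_ge0 => u _; rewrite lee_fin mulr_ge0// tail_ge0.
- by rewrite lee_fin invr_ge0 ltW.
have mb : measurable_fun setT (fun z : R * R => z.2 + z.1 <= y).
  apply: measurable_fun_ler => //; apply: measurable_funD.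
    exact: measurable_snd.
  exact: measurable_fst.
transitivity (\int[P]_w ((T0 w + rsum n w <= y)%R%:R : R)%:E)%E.
  rewrite integral_bool//.
    by congr (P _); apply/seteqP; split => w /=; rewrite TnE.
  by apply: measurable_fun_ler => //; exact: measurable_funD.
rewrite (ge0_integral_indep_rv (f := fun z : R * R => ((z.2 + z.1 <= y)%R%:R : R)%:E)
  mS mT0 (@rsum_T0 n))//;
  last first.
  by apply/measurable_EFinP; exact: measurable_fun_natr.
apply: eq_integral => w _; rewrite integral_bool; last first.
  by apply: measurable_fun_ler => //; exact: measurable_funD.
transitivity (P (T0 @^-1` `]-oo, y - rsum n w])).
  by congr (P _); rewrite preim_le; apply/seteqP; split => w' /=; rewrite lerBrDr.
rewrite T0F; congr (_ * _)%E; rewrite integral_mkcond; apply: eq_integral => u _.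
by rewrite /patch mem_setE in_itv/=; case: ifP; rewrite ?mulr1 ?mulr0.
Qed.

Definition mean_pos n y := (\int[P]_w (Num.max (y - rsum n w) 0)%R%:E)%E.

Let mpos n y : measurable_fun setT (fun w => (Num.max (y - rsum n w) 0)%:E).
Proof.
apply/measurable_EFinP; apply: measurable_maxr => //; apply: measurable_funB => //.
exact: measurable_rsum.
Qed.

Lemma mean_pos_ge0 n y : (0 <= mean_pos n y)%E.
Proof. by apply: integral_ge0 => w _; rewrite lee_fin le_max lexx orbT. Qed.

Lemma mean_pos_le n y : 0 <= y ->
  (mean_pos n y <= y%:E * P [set w | (rsum n w <= y)%R])%E.
Proof.
move=> y0; have mS := measurable_rsum n.
have mb : measurable_fun setT (fun w => rsum n w <= y) by exact: measurable_fun_ler.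
rewrite -integral_bool// -ge0_integralZl//; last first.
  by apply/measurable_EFinP; exact: measurable_fun_natr.
apply: ge0_le_integral => //.
- by move=> w _; rewrite lee_fin le_max lexx orbT.
- apply/measurable_EFinP; apply: measurable_funM => //.
  exact: measurable_fun_natr.
- move=> w _; rewrite -EFinM lee_fin.
  case: (leP (rsum n w) y) => h; rewrite ?mulr1 ?mulr0 ge_max.
    by rewrite y0 andbT lerBlDr lerDl rsum_ge0.
  by rewrite subr_le0 ltW// lexx.
Qed.

Lemma mean_pos_fin n y : 0 <= y -> mean_pos n y \is a fin_num.
Proof.
move=> y0; rewrite ge0_fin_numE ?mean_pos_ge0//.
apply: (le_lt_trans (mean_pos_le n y0)); rewrite lte_mul_pinfty ?lee_fin//.
rewrite (le_lt_trans (probability_le1 _ _)) ?ltry//.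
by apply: measurable_le; exact: measurable_rsum.
Qed.

Lemma mean_pos_step n y :
  (mean_pos n y = taubar%:E * P [set w | (Tn T0 tau n w <= y)%R] + mean_pos n.+1 y)%E.
Proof.
rewrite prob_Tn muleA -EFinM divff ?gt_eqF// mul1e /mean_pos -ge0_integralD//.
- apply: eq_integral => w _; rewrite -EFinD rsumS; congr EFin.
  move: (tau_ge0 n w) (rsum_ge0 n w); move: (tau n w) (rsum n w) => a b a0 b0.
  by rewrite /Num.min /Num.max; case: ifP; case: ifP; case: ifP; lra.
- move=> w _; rewrite lee_fin le_min tau_ge0 andbT.
  by rewrite le_max lexx orbT.
- apply/measurable_EFinP; apply: measurable_minr => //.
  by apply/measurable_EFinP; exact: mpos.
- by move=> w _; rewrite lee_fin le_max lexx orbT.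
Qed.

Definition pT n y := fine (P [set w | (Tn T0 tau n w <= y)%R]).

Lemma pTE n y : P [set w | (Tn T0 tau n w <= y)%R] = (pT n y)%:E.
Proof.
rewrite /pT fineK// fin_num_measure//; apply: measurable_le.
exact: measurable_Tn.
Qed.

Lemma sum_pT N y : 0 <= y ->
  taubar * (\sum_(n < N) pT n y) + fine (mean_pos N y) = y.
Proof.
move=> y0; elim: N => [|N ih].
  rewrite big_ord0 mulr0 add0r /mean_pos.
  under eq_integral do rewrite /rsum big_ord0 subr0.
  by rewrite (max_idPl y0); have := expectation_cst P y; rewrite unlock => ->.
rewrite big_ord_recr/= mulrDr -addrA -[RHS]ih; congr (_ + _).
by rewrite [in RHS]mean_pos_step pTE -EFinM -[in RHS](fineK (mean_pos_fin N.+1 y0)).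
Qed.

Lemma Tn_le_succ n w : Tn T0 tau n w <= Tn T0 tau n.+1 w.
Proof. by rewrite /= lerDl. Qed.

Lemma Tn_homo m n w : (m <= n)%N -> Tn T0 tau m w <= Tn T0 tau n w.
Proof.
move=> mn; apply: (homo_leq (f := fun k => Tn T0 tau k w) (r := <=%R)) mn => //.
- exact: le_trans.
- by move=> k; exact: Tn_le_succ.
Qed.

Lemma pT_homo m n y : (m <= n)%N -> pT n y <= pT m y.
Proof.
move=> mn; rewrite -lee_fin -!pTE; apply: le_measure.
- by rewrite inE; apply: measurable_le; exact: measurable_Tn.
- by rewrite inE; apply: measurable_le; exact: measurable_Tn.
- by move=> w /=; apply: le_trans; exact: Tn_homo.
Qed.

Lemma pT_le n y : 0 <= y -> pT n y <= y / taubar / n.+1%:R.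
Proof.
move=> y0; rewrite ler_pdivlMr ?ltr0Sn// ler_pdivlMr//.
rewrite -[leRHS](sum_pT n.+1 y0) -[leLHS]addr0 lerD//; last first.
  by rewrite fine_ge0// mean_pos_ge0.
rewrite [leLHS]mulrC ler_pM2l// mulr_natr.
have -> : pT n y *+ n.+1 = \sum_(i < n.+1) pT n y by rewrite sumr_const card_ord.
by apply: ler_sum => i _; apply: pT_homo; rewrite -ltnS.
Qed.

(* [P(S_n <= y) P(T_0 <= a) <= P(T_n <= y + a) = O(1 / n)] *)
Lemma mean_pos_cvg0 y : 0 <= y -> fine (mean_pos n y) @[n --> \oo] --> 0.
Proof.
move=> y0; have [a pa] := exists_prob_le_gt0 P mT0.
set p := P _ in pa.
have mT0a : measurable [set w | T0 w <= a%:R] by exact: measurable_le.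
have pf : p \is a fin_num by exact: fin_num_measure.
have p0 : 0 < fine p by rewrite fine_gt0// pa ltey_eq pf.
have le n : fine (mean_pos n y) <= y / fine p * ((y + a%:R) / taubar) * n.+1%:R^-1.
  have mS := measurable_rsum n.
  have ya0 : 0 <= y + a%:R by rewrite addr_ge0.
  have mSy : measurable [set w | rsum n w <= y] by exact: measurable_le.
  have h1 : (P [set w | (Tn T0 tau n w <= y + a%:R)%R] <=
      ((y + a%:R) / taubar / n.+1%:R)%:E)%E by rewrite pTE lee_fin pT_le.
  have h2 : (P [set w | (rsum n w <= y)%R] * p <= ((y + a%:R) / taubar / n.+1%:R)%:E)%E.
    apply: le_trans h1; rewrite /p -!preim_le -(rsum_T0 n)//.
    apply: le_measure; rewrite ?inE.
    - by rewrite !preim_le; exact: measurableI.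
    - by apply: measurable_le; exact: measurable_Tn.
    - move=> w [/=]; rewrite !in_itv/= TnE => h h'.
      by rewrite addrC lerD.
  have Sf : P [set w | (rsum n w <= y)%R] \is a fin_num by exact: fin_num_measure.
  have h3 := mean_pos_le n y0.
  move: h3 h2; rewrite -(fineK (mean_pos_fin n y0)) -(fineK Sf) -(fineK pf).
  rewrite -!EFinM !lee_fin.
  move: (fine _) (fine _) (fine p) p0 => e q p' p'0 eq qp.
  apply: (le_trans eq).
  rewrite [leRHS](_ : _ = y * ((y + a%:R) / taubar / n.+1%:R / p')); last by ring.
  by rewrite ler_wpM2l// ler_pdivlMr.
apply: (@squeeze_cvgr _ _ _ _ (cst 0)
  (fun n => y / fine p * ((y + a%:R) / taubar) * n.+1%:R^-1)).
- by near=> n; rewrite le fine_ge0// mean_pos_ge0.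
- exact: cvg_cst.
- rewrite -[X in _ --> X](mulr0 (y / fine p * ((y + a%:R) / taubar))).
  by apply: cvgMr; exact: cvg_harmonic.
Unshelve. all: by end_near.
Qed.

Lemma nneseries_prob_Tn y : 0 <= y ->
  (\sum_(0 <= n <oo) P [set w | (Tn T0 tau n w <= y)%R] = (y / taubar)%:E)%E.
Proof.
move=> y0; apply/cvg_lim => //.
rewrite (_ : (fun n => _) = (fun n => ((y - fine (mean_pos n y)) / taubar)%:E));
  last first.
  apply/funext => n; rewrite big_mkord; under eq_bigr do rewrite pTE.
  rewrite sumEFin; congr EFin.
  by rewrite -[X in X - _](sum_pT n y0) addrK mulrC mulKf ?gt_eqF.
apply: cvg_EFin; first exact: nearW.
have -> : y / taubar = (y - 0) / taubar by rewrite subr0.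
apply: cvgMl; apply: cvgB; first exact: cvg_cst.
exact: mean_pos_cvg0.
Qed.

Let Tn_ge0 n w : 0 <= Tn T0 tau n w.
Proof. by rewrite TnE addr_ge0// rsum_ge0. Qed.

Let m2id : measurable_fun setT (fun u : R => 2 * u).
Proof. by apply: measurable_funM. Qed.

Let D_measurable : measurable_fun setT (fun u => 1 - F u).
Proof. exact: measurable_funB. Qed.

Let measurable_prob (b : T * R -> bool) : measurable_fun setT b ->
  measurable_fun setT (fun u => P [set w | b (w, u)]).
Proof.
move=> mb.
have : measurable_fun setT (fubini_G P (fun z => ((b z)%:R : R)%:E)).
  apply: measurable_fun_fubini_tonelli_G => //.
  by apply/measurable_EFinP; exact: measurable_fun_natr.
apply: eq_measurable_fun => u _; rewrite /fubini_G integral_bool//.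
exact: measurable_fun_pair1.
Qed.

Let empty_bool : [set w : T | false] = set0.
Proof. by apply/seteqP; split. Qed.

Lemma integral_min2_Tn n t : 0 <= t ->
  (\int[P]_w (Num.min (Num.max (t - Tn T0 tau n w) 0) (tau n w) ^+ 2)%R%:E =
   \int[lam]_(u in `[0%R, t]) ((2 * u * (1 - F u))%:E *
     P [set w | (Tn T0 tau n w <= t - u)%R]))%E.
Proof.
move=> t0; rewrite integral_min2_tau//; last exact: measurable_Tn.
rewrite [RHS]integral_mkcond; apply: eq_integral => u _.
rewrite /patch mem_setE in_itv/=; have [u0/=|u0/=] := leP 0 u; last first.
  by rewrite empty_bool measure0 !mule0.
case: (leP u t) => ut.
  rewrite muleA -EFinM; congr (_ * P _)%E.
  by apply/seteqP; split => w/=; rewrite lerBrDr addrC -lerBrDr.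
rewrite (_ : [set w | _] = set0) ?measure0 ?mule0//.
apply/seteqP; split => // w /= h; have := Tn_ge0 n w; lra.
Qed.

Lemma nneseries_min2_Tn t : 0 <= t ->
  (\sum_(0 <= n <oo) \int[P]_w
     (Num.min (Num.max (t - Tn T0 tau n w) 0) (tau n w) ^+ 2)%R%:E =
   \int[lam]_(u in `[0%R, t]) (2 * u * (1 - F u) * ((t - u) / taubar))%:E)%E.
Proof.
move=> t0; under eq_eseriesr do rewrite integral_min2_Tn//.
have ge0 u : `[0, t]%classic u -> 0 <= 2 * u * (1 - F u).
  by rewrite /= in_itv/= => /andP[u0 _]; rewrite mulr_ge0 ?tail_ge0// mulr_ge0.
rewrite -integral_nneseries//.
- apply: eq_integral => u; rewrite inE => ut.
  rewrite nneseriesZl//.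
  move: ut; rewrite /= in_itv/= => /andP[u0 ut].
  by rewrite nneseries_prob_Tn ?subr_ge0// -EFinM.
- move=> n; apply: measurable_funTS; apply: emeasurable_funM.
    apply/measurable_EFinP; exact: (measurable_funM m2id D_measurable).
  apply: (@measurable_prob (fun z => Tn T0 tau n z.1 <= t - z.2)).
  apply: measurable_fun_ler.
    exact: measurableT_comp (measurable_Tn n) measurable_fst.
  by apply: measurable_funB => //; exact: measurable_snd.
- by move=> n u ut; rewrite mule_ge0// lee_fin ge0.
Qed.

Hypothesis taubarE : (\int[lam]_(u in `[0%R, +oo[) (1 - F u)%:E = taubar%:E)%E.

Lemma prob_T0_gt u : 0 <= u ->
  (taubar%:E * P [set w | (u < T0 w)%R] = \int[lam]_(s in `]u, +oo[) (1 - F s)%:E)%E.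
Proof.
move=> u0.
have -> : [set w | u < T0 w] = ~` (T0 @^-1` `]-oo, u]).
  by rewrite preim_le; apply/seteqP; split => w /=; rewrite ltNge => /negP.
rewrite probability_setC; last by rewrite preim_le; exact: measurable_le.
rewrite T0F.
have split_itv : `[0, +oo[%classic = `[0, u] `|` `]u, +oo[ :> set R.
  by rewrite -itv_bndbnd_setU// bnd_simp.
have ge0 A : (0 <= \int[lam]_(s in A) (1 - F s)%:E)%E.
  by apply: integral_ge0 => s _; rewrite lee_fin tail_ge0.
have := taubarE; rewrite split_itv ge0_integral_setU//=; last 3 first.
- by apply/measurable_EFinP; exact: measurable_funTS.
- by move=> s _; rewrite lee_fin tail_ge0.
- by apply/disj_setPS => s [/=]; rewrite !in_itv/= andbT => /andP[_]; case: ltP.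
move: (ge0 `[0, u]%classic) (ge0 `]u, +oo[%classic).
case: (\int[lam]_(s in `[0%R, u]) _)%E => [a| |]//; last first.
  by case: (\int[lam]_(s in `]u, +oo[) _)%E.
case: (\int[lam]_(s in `]u, +oo[) _)%E => [b| |]//.
move=> _ _ /eqP; rewrite -EFinD eqe => /eqP abt.
transitivity (taubar * (1 - taubar^-1 * a))%:E => //; congr EFin.
by rewrite mulrBr mulr1 mulrA divff ?gt_eqF// mul1r -abt (addrC a) addrK.
Qed.

Lemma integral_min2_T0 t : 0 <= t ->
  (taubar%:E * \int[P]_w (Num.min t (T0 w) ^+ 2)%R%:E =
   \int[lam]_(s in `[0%R, +oo[) ((1 - F s) * Num.min t s ^+ 2)%R%:E)%E.
Proof.
move=> t0.
have mb : measurable_fun setT (fun z : T * R => [&& 0 <= z.2, z.2 <= t & z.2 < T0 z.1]).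
  apply: measurable_and; last apply: measurable_and.
  - by apply: measurable_fun_ler => //; exact: measurable_snd.
  - by apply: measurable_fun_ler => //; exact: measurable_snd.
  - apply: measurable_fun_ltr; first exact: measurable_snd.
    exact: measurableT_comp mT0 measurable_fst.
have mc : measurable_fun setT (fun z : R * R => [&& 0 <= z.2, z.2 <= t & z.2 < z.1]).
  apply: measurable_and; last apply: measurable_and.
  - by apply: measurable_fun_ler => //; exact: measurable_snd.
  - by apply: measurable_fun_ler => //; exact: measurable_snd.
  - by apply: measurable_fun_ltr; [exact: measurable_snd|exact: measurable_fst].
transitivity (taubar%:E * \int[lam]_u ((2 * u)%:E *
    P [set w | [&& 0 <= u, u <= t & u < T0 w]%R]))%E.
  congr (_ * _)%E; under eq_integral do rewrite -{1}(max_idPl t0) -integral_cap_2id//.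
  rewrite (@integral_tonelli_bool _ _ _ P _ (fun u => 2 * u) mb)//.
  by move=> z /andP[z0 _]; rewrite mulr_ge0.
have ge0 s u : 0 <= (1 - F s) * (2 * u * cap t s u).
  rewrite mulr_ge0 ?tail_ge0// /cap.
  by case: (leP 0 u) => u0; rewrite ?mulr0// mulr_ge0// mulr_ge0.
transitivity (\int[lam]_s \int[lam]_u ((1 - F s) * (2 * u * cap t s u))%:E)%E; last first.
  rewrite [RHS]integral_mkcond; apply: eq_integral => s _.
  rewrite /patch mem_setE in_itv/= andbT; case: leP => s0.
    rewrite EFinM -[X in (_ * (X ^+ 2)%:E)%E](_ : Num.min (Num.max t 0) s = _); last first.
      by rewrite (max_idPl t0).
    rewrite -integral_cap_2id// -ge0_integralZl//.
    - apply/measurable_EFinP; apply: (measurable_funM m2id).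
      apply: measurable_fun_natr.
      exact: (measurable_fun_pair2
        (f := fun z : R * R => [&& 0 <= z.2, z.2 <= t & z.2 < z.1])).
    - move=> u _; rewrite lee_fin /cap.
      by case: (leP 0 u) => u0; rewrite ?mulr0// mulr_ge0// mulr_ge0.
    - by rewrite lee_fin tail_ge0.
  apply: integral0_eq => u _; rewrite /cap.
  case: (leP 0 u) => u0; rewrite ?mulr0//=.
  by rewrite (ltNge u s) (le_trans (ltW s0) u0) andbF !mulr0.
rewrite (@fubini_tonelli _ _ _ _ _ lam lam
  (fun z => ((1 - F z.1) * (2 * z.2 * cap t z.1 z.2))%:E))//=; last 2 first.
- apply/measurable_EFinP; apply: measurable_funM.
    exact: measurableT_comp D_measurable measurable_fst.
  apply: measurable_funM; last exact: measurable_fun_natr.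
  exact: measurableT_comp m2id measurable_snd.
- by move=> z; rewrite lee_fin.
rewrite -ge0_integralZl//; last 3 first.
- apply: emeasurable_funM; last exact: measurable_prob mb.
  by apply/measurable_EFinP; exact: m2id.
- move=> u _; have [u0/=|u0/=] := leP 0 u; last by rewrite empty_bool measure0 mule0.
  by rewrite mule_ge0// lee_fin mulr_ge0.
- by rewrite lee_fin ltW.
apply: eq_integral => u _; rewrite /cap.
case: (leP 0 u) => u0 /=; last first.
  rewrite empty_bool measure0 !mule0; apply/esym; apply: integral0_eq => s _.
  by rewrite !mulr0.
case: (leP u t) => ut /=; last first.
  rewrite empty_bool measure0 !mule0; apply/esym; apply: integral0_eq => s _.
  by rewrite !mulr0.
rewrite muleCA prob_T0_gt// integral_mkcond -ge0_integralZl//.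
- apply: eq_integral => s _; rewrite /patch mem_setE in_itv/= andbT.
  by case: ifP => _; rewrite ?mulr0 ?mule0// mulr1 -EFinM mulrC.
- apply/(measurable_restrictT _ _).1 => //.
  by apply/measurable_EFinP; exact: measurable_funTS.
- by move=> s _; apply: erestrict_ge0 => s' _; rewrite lee_fin tail_ge0.
- by rewrite lee_fin mulr_ge0.
Qed.

Definition kern (t s : R) : R := if s <= t then 2 * t * s - s ^+ 2 else t ^+ 2.

Lemma mean_sum_len2 t : 0 <= t ->
  (taubar%:E * (\int[P]_w (Num.min t (T0 w) ^+ 2)%R%:E +
     \sum_(0 <= n <oo) \int[P]_w
       (Num.min (Num.max (t - Tn T0 tau n w) 0) (tau n w) ^+ 2)%R%:E) =
   \int[lam]_(s in `[0%R, +oo[) ((1 - F s) * kern t s)%:E)%E.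
Proof.
move=> t0; rewrite nneseries_min2_Tn//.
have ge0 u : `[0, t]%classic u -> (0 <= (2 * u * (1 - F u) * ((t - u) / taubar))%:E)%E.
  rewrite /= in_itv/= => /andP[u0 ut]; rewrite lee_fin mulr_ge0//.
    by rewrite mulr_ge0 ?tail_ge0// mulr_ge0.
  by rewrite divr_ge0// ?subr_ge0// ltW.
have mf : measurable_fun setT
    (fun u : R => (2 * u * (1 - F u) * ((t - u) / taubar))%:E).
  apply/measurable_EFinP; apply: measurable_funM.
    exact: (measurable_funM m2id D_measurable).
  by apply: measurable_funM => //; exact: measurable_funB.
rewrite ge0_muleDr; last 2 first.
- by apply: integral_ge0 => w _; rewrite lee_fin sqr_ge0.
- exact: integral_ge0.
rewrite integral_min2_T0// -ge0_integralZl//; last 2 first.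
- exact: measurable_funTS.
- by rewrite lee_fin ltW.
have sub : `[0, t] `<=` (`[0, +oo[ : set R).
  by apply: subset_itvl; rewrite bnd_simp.
rewrite -(setIidr sub) integral_mkcondr -ge0_integralD//.
- apply: eq_integral => s; rewrite inE /= in_itv/= andbT => s0.
  rewrite /patch mem_setE in_itv/= s0 /kern /=.
  case: ifP => [st|/negbT]; last first.
    by rewrite -ltNge => ts; rewrite adde0 (min_idPl (ltW ts)).
  rewrite -EFinM -EFinD (min_idPr st); congr EFin; field.
  by rewrite gt_eqF.
- by move=> s _; rewrite lee_fin mulr_ge0 ?tail_ge0// sqr_ge0.
- apply: measurable_funTS; apply/measurable_EFinP; apply: measurable_funM => //.
  by apply: measurable_funX; exact: measurable_minr.
- by move=> s _; apply: erestrict_ge0 => u /ge0 u0; rewrite mule_ge0// lee_fin ltW.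
- apply: measurable_funTS; apply/(measurable_restrictT _ _).1 => //.
  by apply: measurable_funTS; apply: emeasurable_funM.
Qed.

End renewal.

(** * Paths *)

Section paths.
Context d (T : measurableType d) (R : realType).
Variables (T0 : T -> R) (tau : nat -> T -> R).
Local Notation lam := (@lebesgue_measure R).

Definition prevT i w := if i is k.+1 then Tn T0 tau k w else 0.

Definition len t i w :=
  Num.min (Num.max (t - prevT i w) 0) (Tn T0 tau i w - prevT i w).

Lemma len0 t w : 0 <= t -> len t 0 w = Num.min t (T0 w).
Proof. by move=> t0; rewrite /len/= !subr0 (max_idPl t0). Qed.

Lemma lenS t i w :
  len t i.+1 w = Num.min (Num.max (t - Tn T0 tau i w) 0) (tau i w).
Proof. by rewrite /len/= addrAC subrr add0r. Qed.

Lemma Rintegral_itv_co (a b t : R) : 0 <= a -> a <= b ->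
  lam.-integrable `[0, t] (fun s => ((a <= s < b)%R%:R)%:E) /\
  Rintegral lam `[0, t] (fun s => (a <= s < b)%R%:R) = Num.min (Num.max (t - a) 0) (b - a).
Proof.
move=> a0 ab.
have E (s : R) : ((a <= s < b)%R%:R : R) = \1_`[a, b[ s.
  by rewrite indicE mem_setE in_itv.
have mtab : measurable (`[0, t] `&` `[a, b[ : set R) by exact: measurableI.
split.
  have i1 : lam.-integrable `[0, t] (EFin \o \1_`[a, b[).
    by apply: (integrableS measurableT) => //; exact: integrable_indic_itv.
  by apply: eq_integrable i1 => // s _ /=; rewrite E.
transitivity (Rintegral lam `[0, t] (\1_`[a, b[)).
  by apply: eq_Rintegral => s _; rewrite E.
rewrite /Rintegral integral_indic//.
have [ta|at_] := ltP t a.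
  rewrite (_ : _ `&` _ = set0); last first.
    apply/seteqP; split => // s /=; rewrite !in_itv/= => -[/andP[as_ _] /andP[s0 st]].
    by have := lt_le_trans ta as_; rewrite ltNge st.
  by rewrite measure0/= (max_idPr _) ?subr_le0 ?(ltW ta)// (min_idPl _)// subr_ge0.
rewrite (max_idPl _) ?subr_ge0//; have [bt|tb] := leP b t.
  rewrite (_ : _ `&` _ = `[a, b[%classic); last first.
    apply/seteqP; split => s /=; rewrite !in_itv/=; first by case.
    by move=> /andP[as_ sb]; rewrite as_ sb (le_trans a0 as_) (le_trans (ltW sb) bt).
  rewrite [X in fine X]lebesgue_measure_itv/= lte_fin (min_idPr _) ?lerD2r//.
  by case: ltP => //= ba; apply/eqP; rewrite eq_sym subr_eq0 eq_le ab ba.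
rewrite (_ : _ `&` _ = `[a, t]%classic); last first.
  apply/seteqP; split => s /=; rewrite !in_itv/=.
    by move=> [/andP[-> _] /andP[_ ->]].
  by move=> /andP[as_ st]; rewrite as_ st (le_trans a0 as_) (le_lt_trans st tb).
rewrite [X in fine X]lebesgue_measure_itv/= lte_fin (min_idPl _) ?lerD2r ?(ltW tb)//.
by case: ltP => //= ta; apply/eqP; rewrite eq_sym subr_eq0 eq_le at_ ta.
Qed.

Lemma Rintegral_step (c a b : nat -> R) (t : R) n :
  (forall i, 0 <= a i) -> (forall i, a i <= b i) ->
  lam.-integrable `[0, t] (EFin \o (fun s => \sum_(i < n) c i * (a i <= s < b i)%R%:R)) /\
  Rintegral lam `[0, t] (fun s => \sum_(i < n) c i * (a i <= s < b i)%R%:R) =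
  \sum_(i < n) c i * Num.min (Num.max (t - a i) 0) (b i - a i).
Proof.
move=> a0 ab; elim: n => [|n [ih1 ih2]].
  rewrite big_ord0; split.
    apply: eq_integrable (integrable0 _ _) => // s _ /=; by rewrite big_ord0.
  rewrite (_ : (fun s => _) = cst 0); last by apply/funext => s; rewrite big_ord0.
  by rewrite Rintegral_cst// mul0r.
have [i1 i2] := Rintegral_itv_co t (a0 n) (ab n).
have ic : lam.-integrable `[0, t] (EFin \o (fun s => c n * (a n <= s < b n)%R%:R)).
  by apply: eq_integrable (integrableZl _ (c n) i1).
have E : (fun s => \sum_(i < n.+1) c i * (a i <= s < b i)%R%:R) =
    (fun s => \sum_(i < n) c i * (a i <= s < b i)%R%:R + c n * (a n <= s < b n)%R%:R).
  by apply/funext => s; rewrite big_ord_recr.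
rewrite E; split.
  exact: (integrableD _ ih1 ic).
by rewrite RintegralD// ih2 RintegralZl// i2 big_ord_recr.
Qed.

Variables (m : nat) (V : nat -> T -> m.-tuple R) (w : T).
Hypothesis T0_ge0 : 0 <= T0 w.
Hypothesis tau_ge0 : forall i, 0 <= tau i w.

Let Tn_homo_at i k : (i <= k)%N -> Tn T0 tau i w <= Tn T0 tau k w.
Proof.
move=> ik; apply: (homo_leq (f := fun k => Tn T0 tau k w) (r := <=%R)) ik => //.
- exact: le_trans.
- by move=> n; rewrite /= lerDl.
Qed.

Let prevT_ge0 i : 0 <= prevT i w.
Proof.
by case: i => //= i; rewrite (le_trans T0_ge0)//; exact: (@Tn_homo_at 0 i).
Qed.

Let prevT_le i : prevT i w <= Tn T0 tau i w.
Proof. by case: i => //= i; rewrite lerDl. Qed.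

Lemma len_ge0 t i : 0 <= len t i w.
Proof. by rewrite /len le_min subr_ge0 prevT_le le_max lexx orbT. Qed.

Lemma len_le t i : 0 <= t -> len t i w <= t.
Proof.
by move=> t0; rewrite /len ge_min ge_max t0 andbT lerBlDr lerDl prevT_ge0.
Qed.

Lemma len_eq0 t n i : t < Tn T0 tau n w -> (n < i)%N -> len t i w = 0.
Proof.
move=> tn; case: i => // i ni; rewrite lenS (max_idPr _) ?(min_idPl _)//.
by rewrite subr_le0 (le_trans (ltW tn))// Tn_homo_at.
Qed.

Lemma Vel_sum n s j : 0 <= s -> s < Tn T0 tau n w ->
  tnth (Vel T0 tau V s w) j =
  \sum_(i < n.+1) tnth (V i w) j * (prevT i w <= s < Tn T0 tau i w)%R%:R.
Proof.
move=> s0 sn; rewrite /Vel; case: pselect => [h|]; last by case; exists n.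
case: ex_minnP => k sk kmin.
have kn : (k < n.+1)%N by rewrite ltnS kmin.
rewrite (bigD1 (Ordinal kn))//= sk big1 ?addr0; last first.
  move=> i; rewrite -val_eqE/= => ik.
  case: (ltngtP i k) => [ltik|ltki|eqik]; last by rewrite eqik eqxx in ik.
  - have /negbTE -> : ~~ (s < Tn T0 tau i w).
      by apply/negP => /kmin; rewrite leqNgt ltik.
    by rewrite andbF mulr0.
  - have /negbTE -> : ~~ (prevT i w <= s); last by rewrite mulr0.
    rewrite -ltNge (lt_le_trans sk)//.
    by case: (nat_of_ord i) ltki => // i' ltki /=; exact: Tn_homo_at.
have -> : prevT k w <= s.
  case: k {kn sk} kmin => // k kmin /=; rewrite leNgt; apply/negP => /kmin.
  by rewrite ltnn.
by rewrite mulr1.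
Qed.

Lemma Xpos_sum n t j : t < Tn T0 tau n w ->
  Xpos T0 tau V t j w = \sum_(i < n.+1) tnth (V i w) j * len t i w.
Proof.
move=> tn; rewrite /Xpos.
have [_ <-] := Rintegral_step (fun i => tnth (V i w) j) t n.+1 prevT_ge0 prevT_le.
apply: eq_Rintegral => s; rewrite inE/= in_itv/= => /andP[s0 st].
exact: Vel_sum (le_lt_trans st tn).
Qed.

End paths.

(** * Second moment of the displacement *)

Lemma integral_sumr d (T : measurableType d) (R : realType)
    (mu : {measure set T -> \bar R}) n (f : 'I_n -> T -> R) :
  (forall i, mu.-integrable setT (EFin \o f i)) ->
  mu.-integrable setT (EFin \o (fun x => \sum_i f i x)) /\
  (\int[mu]_x (\sum_i f i x)%:E = \sum_i \int[mu]_x (f i x)%:E)%E.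
Proof.
move=> intf.
have E x : ((\sum_i f i x)%:E = \sum_i (f i x)%:E)%E by rewrite sumEFin.
split.
  have := @integrable_sum _ _ _ mu setT measurableT _ (index_enum 'I_n) xpredT
    (fun i => EFin \o f i) (fun i _ => intf i).
  by apply: eq_integrable => // x _ /=; rewrite E.
under eq_integral do rewrite E.
exact: (integral_sum measurableT intf).
Qed.

Section second_moment.
Context d (T : measurableType d) (R : realType) (P : probability T R).
Context (m : nat) (V : nat -> T -> m.-tuple R) (v2 : R) (z : nat -> T -> R) (M : R).
Hypothesis iV : forall i (j : 'I_m), P.-integrable setT (fun w => (tnth (V i w) j)%:E) /\
  (\int[P]_w (tnth (V i w) j)%:E = 0)%E.
Hypothesis V2 : forall i, (\int[P]_w (\sum_(j < m) tnth (V i w) j ^+ 2)%:E = v2%:E)%E.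
Hypothesis mz : forall i, measurable_fun setT (z i).
Hypothesis z_le : forall i w, `|z i w| <= M.
Hypothesis indep_off : forall i k (j : 'I_m), i != k ->
  indep_rv P (fun w => tnth (V k w) j * (z i w * z k w)) (fun w => tnth (V i w) j).
Hypothesis indep_diag : forall i (j : 'I_m),
  indep_rv P (fun w => z i w ^+ 2) (fun w => tnth (V i w) j ^+ 2).

Let mVj i (j : 'I_m) : measurable_fun setT (fun w => tnth (V i w) j).
Proof. by apply/measurable_EFinP; have [/measurable_int] := iV i j. Qed.

Let mVj2 i (j : 'I_m) : measurable_fun setT (fun w => tnth (V i w) j ^+ 2).
Proof. exact: measurable_funX. Qed.

Let iV2 i j : P.-integrable setT (EFin \o (fun w => tnth (V i w) j ^+ 2)).
Proof.
apply/integrableP; split; first exact/measurable_EFinP.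
apply: (@le_lt_trans _ _ (\int[P]_w (\sum_(j < m) tnth (V i w) j ^+ 2)%:E)%E); last first.
  by rewrite V2 ltry.
apply: ge0_le_integral => //.
- apply: measurableT_comp => //; exact/measurable_EFinP.
- by apply/measurable_EFinP; apply: measurable_sum => k.
- move=> w _ /=; rewrite lee_fin ger0_norm ?sqr_ge0// (bigD1 j)//= lerDl.
  by apply: sumr_ge0 => k _; rewrite sqr_ge0.
Qed.

Let izz i k : P.-integrable setT (EFin \o (fun w => z i w * z k w)).
Proof.
apply: measurable_bounded_integrable => //.
- by rewrite /= probability_setT ltry.
- exact: measurable_funM.
- exists (M * M); split; first exact: num_real.
  move=> x Mx w _; rewrite /= normrM (le_trans _ (ltW Mx))// ler_pM//.
Qed.

Let term i k j w := tnth (V k w) j * (z i w * z k w) * tnth (V i w) j.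

Let iVz i k j : P.-integrable setT (EFin \o (fun w => tnth (V k w) j * (z i w * z k w))).
Proof.
have [iVk _] := iV k j.
have := @integrableMl _ _ _ P setT measurableT _ (fun w => z i w * z k w) iVk.
apply.
- exact: measurable_funM.
- exists (M * M); split; first exact: num_real.
  move=> x Mx w _; rewrite /= normrM (le_trans _ (ltW Mx))// ler_pM//.
Qed.

Let term_diag i j w : term i i j w = z i w ^+ 2 * tnth (V i w) j ^+ 2.
Proof. by rewrite /term; ring. Qed.

Let iterm i k j : P.-integrable setT (EFin \o term i k j).
Proof.
have [->|ik] := eqVneq i k.
  have := indep_rv_integrableM (@indep_diag k j) (izz k k) (iV2 k j).
  by apply: eq_integrable => // w _; rewrite /= term_diag.
have [iVi _] := iV i j.
exact: (indep_rv_integrableM (indep_off j ik) (iVz i k j) iVi).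
Qed.

Let v i j := fine (\int[P]_w (tnth (V i w) j ^+ 2)%:E).
Let e i := fine (\int[P]_w (z i w ^+ 2)%:E).

Let vE i j : (\int[P]_w (tnth (V i w) j ^+ 2)%:E = (v i j)%:E)%E.
Proof. by rewrite fineK// (integrable_fin_num measurableT (iV2 i j)). Qed.

Let eE i : (\int[P]_w (z i w ^+ 2)%:E = (e i)%:E)%E.
Proof. by rewrite fineK// (integrable_fin_num measurableT (izz i i)). Qed.

Let integral_term i k j :
  (\int[P]_w (term i k j w)%:E = (if i == k then v i j * e i else 0)%:E)%E.
Proof.
have [<-|ik] := eqVneq i k.
  under eq_integral do rewrite term_diag.
  rewrite (indep_rv_integralM (@indep_diag i j) (izz i i) (iV2 i j)) eE vE.
  by rewrite -EFinM mulrC.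
have [iVi Vi0] := iV i j.
by rewrite (indep_rv_integralM (indep_off j ik) (iVz i k j) iVi) Vi0 mule0.
Qed.

Let sum_v i : \sum_(j < m) v i j = v2.
Proof.
apply: EFin_inj; rewrite -(V2 i) -sumEFin.
have [_ ->] := integral_sumr (iV2 i).
by apply: eq_bigr => j _; rewrite vE.
Qed.

Lemma second_moment n :
  (\int[P]_w (\sum_(j < m) (\sum_(i < n) tnth (V i w) j * z i w) ^+ 2)%:E =
   v2%:E * \sum_(i < n) \int[P]_w (z i w ^+ 2)%:E)%E.
Proof.
under eq_bigr do rewrite eE.
rewrite sumEFin -EFinM.
transitivity (\int[P]_w (\sum_(j < m) \sum_(i < n) \sum_(k < n) term i k j w)%:E)%E.
  apply: eq_integral => w _; congr EFin; apply: eq_bigr => j _.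
  rewrite expr2 big_distrlr/=; apply: eq_bigr => i _; apply: eq_bigr => k _.
  by rewrite /term; ring.
have s1 i j := integral_sumr (fun k : 'I_n => iterm i k j).
have s2 j := integral_sumr (fun i : 'I_n => (s1 i j).1).
rewrite (integral_sumr (fun j => (s2 j).1)).2.
under eq_bigr => j _.
  rewrite (s2 j).2.
  under eq_bigr => i _.
    rewrite (s1 i j).2; under eq_bigr do rewrite integral_term.
    rewrite sumEFin (bigD1 i)//= eqxx big1 ?addr0; last first.
      by move=> k ki; rewrite ifN// eq_sym.
    over.
  rewrite sumEFin.
  over.
rewrite sumEFin exchange_big/=; congr EFin; rewrite mulr_sumr.
by apply: eq_bigr => i _; rewrite -mulr_suml sum_v.
Qed.

End second_moment.

Section mean_square_displacement.
Context (R : realType) (F : R -> R) (v2 taubar : R) (m : nat).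
Context (d : measure_display) (T : measurableType d) (P : probability T R).
Context (T0 : T -> R) (tau : nat -> T -> R) (V : nat -> T -> m.-tuple R).
Local Notation lam := (@lebesgue_measure R).
Hypothesis mF : measurable_fun setT F.
Hypothesis F0 : F 0 = 0.
Hypothesis taubar_gt0 : 0 < taubar.
Hypothesis mT0 : measurable_fun setT T0.
Hypothesis mtau : forall i, measurable_fun setT (tau i).
Hypothesis mV : forall i, measurable_fun setT (V i).
Hypothesis tauF : forall i t, P (tau i @^-1` `]-oo, t]) = (F t)%:E.
Hypothesis T0F : forall t, P (T0 @^-1` `]-oo, t]) =
  ((taubar^-1)%:E * \int[lam]_(u in `[0%R, t]) (1 - F u)%:E)%E.
Hypothesis taubarE : (\int[lam]_(u in `[0%R, +oo[) (1 - F u)%:E = taubar%:E)%E.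

Definition family (k : eq_index) : set (set T) := match k with
  | None => gen_events T0
  | Some (inl n) => gen_events (tau n)
  | Some (inr n) => gen_events (V n) end.

Hypothesis indep : mutually_independent P family.
Hypothesis iV : forall i (j : 'I_m), P.-integrable setT (fun w => (tnth (V i w) j)%:E) /\
  (\int[P]_w (tnth (V i w) j)%:E = 0)%E.
Hypothesis V2 : forall i, (\int[P]_w (\sum_(j < m) tnth (V i w) j ^+ 2)%:E = v2%:E)%E.

Let mE k A : family k A -> measurable A.
Proof.
by case: k => [[n|n]|] [B mB <-]; rewrite -[_ @^-1` _]setTI;
  [exact: mtau|exact: mV|exact: mT0].
Qed.

Let ET k : family k setT.
Proof. by case: k => [[n|n]|]; exists setT => //; exact: measurableT. Qed.

Let EI k : setI_closed (family k).
Proof.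
by case: k => [[n|n]|] _ _ [B mB <-] [C mC <-]; exists (B `&` C) => //;
  exact: measurableI.
Qed.

(* [T0] and [tau i] are nonnegative only almost surely. *)
Let S0 w := Num.max (T0 w) 0.
Let sig i w := Num.max (tau i w) 0.

Let famT0 C : measurable C -> family None (S0 @^-1` C).
Proof.
move=> mC; exists [set x | C (Num.max x 0)] => //=.
rewrite -[[set _ | _]]setTI.
exact: (@measurable_maxr _ _ R setT id (cst 0) (@measurable_id _ _ _) (measurable_cst _)).
Qed.

Let famtau i C : measurable C -> family (Some (inl i)) (sig i @^-1` C).
Proof.
move=> mC; exists [set x | C (Num.max x 0)] => //=.
rewrite -[[set _ | _]]setTI.
exact: (@measurable_maxr _ _ R setT id (cst 0) (@measurable_id _ _ _) (measurable_cst _)).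
Qed.

Let famV i (f : m.-tuple R -> R) C : measurable_fun setT f -> measurable C ->
  family (Some (inr i)) ((fun w => f (V i w)) @^-1` C).
Proof.
move=> mf mC; exists (f @^-1` C) => //=.
by rewrite -[f @^-1` C]setTI; exact: mf.
Qed.

Let O k := g_sigma_algebraType (others family k).

Let oT0 k : k != None -> measurable_fun setT (S0 : O k -> R).
Proof. by move=> k0; apply: (measurable_fun_others ET (i := None)); rewrite 1?eq_sym. Qed.

Let otau k i : k != Some (inl i) -> measurable_fun setT (sig i : O k -> R).
Proof.
move=> k0; apply: (measurable_fun_others ET (i := Some (inl i))); rewrite 1?eq_sym//.
exact: famtau.
Qed.

Let oV k i (f : m.-tuple R -> R) : k != Some (inr i) -> measurable_fun setT f ->
  measurable_fun setT ((fun w => f (V i w)) : O k -> R).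
Proof.
move=> k0 mf; apply: (measurable_fun_others ET (i := Some (inr i))); rewrite 1?eq_sym//.
by move=> C mC; exact: famV.
Qed.

Let oTn k n : k != None -> (forall i, (i < n)%N -> k != Some (inl i)) ->
  measurable_fun setT (Tn S0 sig n : O k -> R).
Proof.
move=> k0; elim: n => [_|n ih kn] /=; first exact: oT0.
apply: (@measurable_funD _ (O k)); last by apply: otau; exact: kn.
by apply: ih => i ilt; apply: kn; rewrite ltnS ltnW.
Qed.

Let orsum k n : (forall i, (i < n)%N -> k != Some (inl i)) ->
  measurable_fun setT (rsum sig n : O k -> R).
Proof.
move=> kn; apply: (@measurable_sum _ (O k)) => i.
by apply: otau; exact: kn.
Qed.

Let iS n : indep_rv P (rsum sig n) S0.
Proof. by apply: (others_indep_rv mE ET EI indep (k := None)) => //; exact: orsum. Qed.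

Let lt_neq n i : (i < n)%N -> (Some (inl n) : eq_index) != Some (inl i).
Proof. by move=> h; apply/eqP => -[] e; rewrite e ltnn in h. Qed.

Let iStau n : indep_rv P (rsum sig n) (sig n).
Proof.
apply: (others_indep_rv mE ET EI indep (k := Some (inl n))); last exact: famtau.
by apply: orsum; exact: lt_neq.
Qed.

Let iTtau n : indep_rv P (Tn S0 sig n) (sig n).
Proof.
apply: (others_indep_rv mE ET EI indep (k := Some (inl n))); last exact: famtau.
by apply: oTn => //; exact: lt_neq.
Qed.

Variable t : R.
Hypothesis t0 : 0 <= t.

Let z n i w := (t < Tn S0 sig n w)%R%:R * len S0 sig t i w.

Let oTnV i n : measurable_fun setT (Tn S0 sig n : O (Some (inr i)) -> R).
Proof. exact: oTn. Qed.

Let oz k n i : measurable_fun setT (z n i : O (Some (inr k)) -> R).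
Proof.
have mprev : measurable_fun setT (prevT S0 sig i : O (Some (inr k)) -> R).
  by case: i => [|i] /=; [exact: measurable_cst|exact: oTnV].
apply: (@measurable_funM _ (O (Some (inr k)))).
  apply: (@measurable_fun_natr _ _ (O (Some (inr k)))).
  by apply: (@measurable_fun_ltr _ (O (Some (inr k)))).
apply: (@measurable_minr _ (O (Some (inr k)))).
  apply: (@measurable_maxr _ (O (Some (inr k)))) => //.
  exact: (@measurable_funB _ (O (Some (inr k)))).
exact: (@measurable_funB _ (O (Some (inr k)))).
Qed.

Let S0_ge0 w : 0 <= S0 w. Proof. by rewrite le_max lexx orbT. Qed.
Let sig_ge0 i w : 0 <= sig i w. Proof. by rewrite le_max lexx orbT. Qed.

Let mS0 : measurable_fun setT S0. Proof. exact: measurable_maxr. Qed.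
Let msig i : measurable_fun setT (sig i). Proof. exact: measurable_maxr. Qed.

Let max_le (X : T -> R) (a : R) : (fun w => Num.max (X w) 0) @^-1` `]-oo, a] =
  if 0 <= a then X @^-1` `]-oo, a] else set0.
Proof.
case: ifPn => a0; apply/seteqP; split => w //=; rewrite !in_itv/= ge_max ?a0 ?andbT//.
by rewrite (negbTE a0) andbF.
Qed.

Let sigF i a : P (sig i @^-1` `]-oo, a]) = (F a)%:E.
Proof.
rewrite max_le; case: ifPn => [_|]; first exact: tauF.
rewrite -ltNge => a0; rewrite measure0; apply/esym/eqP.
rewrite -(tauF i) -measure_le0 -[leRHS](_ : (F 0)%:E = _); last by rewrite F0.
rewrite -(tauF i); apply: le_measure; rewrite ?inE.
- by rewrite -[_ @^-1` _]setTI; exact: mtau.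
- by rewrite -[_ @^-1` _]setTI; exact: mtau.
- by move=> w /=; rewrite !in_itv/= => h; rewrite (le_trans h)// ltW.
Qed.

Let S0F a : P (S0 @^-1` `]-oo, a]) =
  ((taubar^-1)%:E * \int[lam]_(u in `[0%R, a]) (1 - F u)%:E)%E.
Proof.
rewrite max_le; case: ifPn => [_|]; first exact: T0F.
by move=> a0; rewrite set_itv_ge ?integral_set0 ?mule0 ?measure0// bnd_simp.
Qed.

Let mTn n : measurable_fun setT (Tn S0 sig n).
Proof. exact: measurable_Tn. Qed.

Let N0 := [set w | forall n, Tn S0 sig n w <= t].

Let mN0 : measurable N0.
Proof.
rewrite (_ : N0 = \bigcap_n [set w | Tn S0 sig n w <= t]); last first.
  by apply/seteqP; split => w /=; [move=> h n _; exact: h|move=> h n; exact: h].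
by apply: bigcapT_measurable => n; exact: measurable_le.
Qed.

Let PN0 : P N0 = 0%E.
Proof.
have fN0 : P N0 \is a fin_num by exact: fin_num_measure.
have h n : fine (P N0) <= t / taubar / n.+1%:R.
  apply: le_trans (pT_le mF taubar_gt0 mS0 msig sig_ge0 sigF S0F iS iStau n t0).
  apply: fine_le => //; first by apply: fin_num_measure => //; exact: measurable_le.
  apply: le_measure; rewrite ?inE//; first exact: measurable_le.
  by move=> w; exact.
apply/eqP; rewrite -(fineK fN0) eqe eq_le fine_ge0// andbT leNgt; apply/negP => p0.
have := truncnS_gt (t / taubar / fine (P N0)); rewrite ltr_pdivrMr//.
set n := Num.truncn _ => hn; have := h n.
by rewrite ler_pdivlMr ?ltr0Sn// [leLHS]mulrC leNgt hn.
Qed.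

Let neg := [set w | T0 w <= 0] `|` \bigcup_i [set w | tau i w <= 0].

Let mneg : measurable neg.
Proof.
apply: measurableU; first exact: measurable_le.
by apply: bigcupT_measurable => i; exact: measurable_le.
Qed.

Let Pneg : P neg = 0%E.
Proof.
apply/negligibleP => //; apply: negligibleU.
  apply/negligibleP; first exact: measurable_le.
  by have := T0F 0; rewrite preim_le set_itv1 integral_set1 mule0.
apply: negligible_bigcup => i; apply/negligibleP; first exact: measurable_le.
by have := tauF i 0; rewrite preim_le F0.
Qed.

Let Tn_pos w n : ~ neg w -> Tn S0 sig n w = Tn T0 tau n w.
Proof.
move=> Nw.
have T0w : 0 <= T0 w by apply/ltW; rewrite ltNge; apply/negP => h; apply: Nw; left.
have tauw i : 0 <= tau i w.
  by apply/ltW; rewrite ltNge; apply/negP => h; apply: Nw; right; exists i.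
elim: n => [|n ih] /=; first by rewrite /S0 (max_idPl _).
by rewrite ih /sig (max_idPl _).
Qed.

Let A n w := t < Tn S0 sig n w.

Let A_homo n k w : (n <= k)%N -> A n w -> A k w.
Proof.
move=> nk; rewrite /A => h; apply: (lt_le_trans h).
exact: Tn_homo.
Qed.

Let sum_z (f : R -> R) (c : nat -> R) n k w : f 0 = 0 -> A n w -> (n <= k)%N ->
  \sum_(i < k.+1) c i * f (z k i w) = \sum_(i < n.+1) c i * f (len S0 sig t i w).
Proof.
move=> f0 An nk.
rewrite -(big_mkord xpredT (fun i => c i * f (z k i w))).
rewrite -(big_mkord xpredT (fun i => c i * f (len S0 sig t i w))).
rewrite (@big_cat_nat _ _ _ n.+1)//= [X in _ + X]big_nat_cond [X in _ + X]big1 ?addr0.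
  by apply: eq_bigr => i _; rewrite /z -/(A k w) (A_homo nk An) mul1r.
move=> i /andP[/andP[ni _] _]; rewrite /z (@len_eq0 _ _ _ S0 sig w _ _ n)//.
by rewrite mulr0 f0 mulr0.
Qed.

Let z_out n i w : ~~ A n w -> z n i w = 0.
Proof. by rewrite /z -/(A n w) => /negbTE ->; rewrite mul0r. Qed.

Let g n w := \sum_(j < m) (\sum_(i < n.+1) tnth (V i w) j * z n i w) ^+ 2.
Let q n w := \sum_(i < n.+1) z n i w ^+ 2.

Let gE n k w : A n w -> (n <= k)%N ->
  g k w = \sum_(j < m) (\sum_(i < n.+1) tnth (V i w) j * len S0 sig t i w) ^+ 2.
Proof.
move=> An nk; apply: eq_bigr => j _; congr (_ ^+ 2).
exact: (@sum_z id (fun i => tnth (V i w) j)).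
Qed.

Let qE n k w : A n w -> (n <= k)%N -> q k w = \sum_(i < n.+1) len S0 sig t i w ^+ 2.
Proof.
move=> An nk; rewrite /q; under eq_bigr do rewrite -[_ ^+ 2]mul1r.
rewrite (@sum_z (fun x => x ^+ 2) (fun=> 1) n)// ?expr0n//.
by under eq_bigr do rewrite mul1r.
Qed.

Let g_out n w : ~~ A n w -> g n w = 0.
Proof.
move=> An; rewrite /g big1// => j _; rewrite big1 ?expr0n// => i _.
by rewrite z_out ?mulr0.
Qed.

Let q_out n w : ~~ A n w -> q n w = 0.
Proof. by move=> An; rewrite /q big1// => i _; rewrite z_out ?expr0n. Qed.

Let g_ge0 n w : 0 <= g n w.
Proof. by apply: sumr_ge0 => j _; rewrite sqr_ge0. Qed.

Let q_ge0 n w : 0 <= q n w.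
Proof. by apply: sumr_ge0 => j _; rewrite sqr_ge0. Qed.

Let g_nd w : nondecreasing_seq (fun n => (g n w)%:E).
Proof.
move=> n k nk; rewrite lee_fin; have [An|/g_out ->//] := boolP (A n w).
by rewrite (gE An nk) (gE An (leqnn n)).
Qed.

Let q_nd w : nondecreasing_seq (fun n => (q n w)%:E).
Proof.
move=> n k nk; rewrite lee_fin; have [An|/q_out ->//] := boolP (A n w).
by rewrite (qE An nk) (qE An (leqnn n)).
Qed.

Let mz n i : measurable_fun setT (z n i).
Proof. by apply: (others_measurable_fun mE); exact: (@oz 0). Qed.

Let mVj i j : measurable_fun setT (fun w => tnth (V i w) j).
Proof. by apply/measurable_EFinP; have [/measurable_int] := iV i j. Qed.

Let mg n : measurable_fun setT (fun w => (g n w)%:E).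
Proof.
apply/measurable_EFinP; apply: measurable_sum => j; apply: measurable_funX.
by apply: measurable_sum => i; exact: measurable_funM.
Qed.

Let mq n : measurable_fun setT (fun w => (q n w)%:E).
Proof.
by apply/measurable_EFinP; apply: measurable_sum => j; exact: measurable_funX.
Qed.

Let integral_g n : (\int[P]_w (g n w)%:E = v2%:E * \int[P]_w (q n w)%:E)%E.
Proof.
have z_le i w : `|z n i w| <= t.
  rewrite /z normrM ger0_norm// [X in _ * X]ger0_norm ?len_ge0//.
  by case: (_ < _); rewrite ?mul1r ?mul0r// len_le.
rewrite (second_moment iV V2 (mz n) z_le).
- congr (_ * _)%E; rewrite -ge0_integral_sum//.
  + by apply: eq_integral => w _; rewrite sumEFin.
  + by move=> i; apply/measurable_EFinP; exact: measurable_funX.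
  + by move=> i w _; rewrite lee_fin sqr_ge0.
- move=> i k j ik.
  apply: (others_indep_rv mE ET EI indep (k := Some (inr i))).
    apply: (@measurable_funM _ (O (Some (inr i)))).
      apply: (@oV _ k (fun x => tnth x j)); last exact: measurable_tnth.
      by apply/eqP => -[] e; rewrite e eqxx in ik.
    by apply: (@measurable_funM _ (O (Some (inr i)))); exact: oz.
  by move=> C mC; apply: (@famV i (fun x => tnth x j)) => //; exact: measurable_tnth.
- move=> i j.
  apply: (others_indep_rv mE ET EI indep (k := Some (inr i))).
    by apply: (@measurable_funX _ (O (Some (inr i)))); exact: oz.
  move=> C mC; apply: (@famV i (fun x => tnth x j ^+ 2)) => //.
  by apply: measurable_funX; exact: measurable_tnth.
Qed.

Let A_ex w : ~ N0 w -> exists n, A n w.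
Proof. by move=> /existsNP[n /negP]; rewrite -ltNge => h; exists n. Qed.

Let msd_lim : (msd P T0 tau V t = limn (fun n => \int[P]_w (g n w)%:E))%E.
Proof.
have ge0 n w : setT w -> (0 <= (g n w)%:E)%E by rewrite lee_fin.
rewrite -(monotone_convergence P measurableT mg ge0 (fun w _ => @g_nd w)).
apply: (@ge0_null_eq_integral _ _ _ P (N0 `|` neg)).
- exact: measurableU.
- by apply/negligibleP; [exact: measurableU|apply: negligibleU; exact/negligibleP].
- by move=> w; rewrite lee_fin; apply: sumr_ge0 => j _; rewrite sqr_ge0.
- move=> w; apply: lime_ge; first exact/ereal_nondecreasing_is_cvgn/g_nd.
  by apply: nearW => n; rewrite lee_fin.
move=> w /not_orP[/A_ex[n An] Nw].
apply/esym/cvg_lim => //; apply: cvg_near_cst.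
near=> k.
rewrite (@gE n k)//; last by near: k; exact: nbhs_infty_ge.
congr EFin; apply: eq_bigr => j _; congr (_ ^+ 2).
have T0w : 0 <= T0 w by apply/ltW; rewrite ltNge; apply/negP => h; apply: Nw; left.
have tauw i : 0 <= tau i w.
  by apply/ltW; rewrite ltNge; apply/negP => h; apply: Nw; right; exists i.
rewrite (Xpos_sum V T0w tauw (n := n)) -?Tn_pos//.
apply: eq_bigr => i _; congr (_ * _).
have prevE k' : prevT T0 tau k' w = prevT S0 sig k' w.
  by case: k' => //= k'; rewrite Tn_pos.
by rewrite /len prevE -Tn_pos.
Unshelve. all: by end_near.
Qed.

Let lim_q : limn (fun n => \int[P]_w (q n w)%:E)%E =
  (\sum_(0 <= i <oo) \int[P]_w (len S0 sig t i w ^+ 2)%:E)%E.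
Proof.
have mlen i : measurable_fun setT (fun w => len S0 sig t i w).
  rewrite /len; have mprev : measurable_fun setT (prevT S0 sig i).
    by case: i => [|i] /=; [exact: measurable_cst|exact: mTn].
  apply: measurable_minr; last exact: measurable_funB.
  by apply: measurable_maxr => //; exact: measurable_funB.
have ge0 n w : setT w -> (0 <= (q n w)%:E)%E by rewrite lee_fin.
rewrite -(monotone_convergence P measurableT mq ge0 (fun w _ => @q_nd w)).
rewrite -integral_nneseries//; last 2 first.
- by move=> i; apply/measurable_EFinP; exact: measurable_funX.
- by move=> i w _; rewrite lee_fin sqr_ge0.
apply: (@ge0_null_eq_integral _ _ _ P N0) => //.
- move=> w; apply: lime_ge; first exact/ereal_nondecreasing_is_cvgn/q_nd.
  by apply: nearW => n; rewrite lee_fin.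
- by move=> w; apply: nneseries_ge0 => i _ _; rewrite lee_fin sqr_ge0.
move=> w /A_ex[n An].
transitivity ((\sum_(i < n.+1) len S0 sig t i w ^+ 2)%:E).
  apply/cvg_lim => //; apply: cvg_near_cst; near=> k.
  by rewrite (@qE n k)//; near: k; exact: nbhs_infty_ge.
apply/esym/cvg_lim => //; apply: cvg_near_cst; near=> k.
have nk : (n.+1 <= k)%N by near: k; exact: nbhs_infty_ge.
rewrite (@big_cat_nat _ _ _ n.+1)//= [X in (_ + X)%E]big_nat_cond [X in (_ + X)%E]big1.
  by rewrite adde0 big_mkord sumEFin.
move=> i /andP[/andP[ni _] _].
by rewrite (@len_eq0 _ _ _ S0 sig w _ _ n)// expr0n.
Unshelve. all: by end_near.
Qed.

Lemma msdE : (msd P T0 tau V t =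
  (v2 / taubar)%:E * \int[lam]_(s in `[0%R, +oo[) ((1 - F s) * kern t s)%:E)%E.
Proof.
rewrite msd_lim; under eq_fun do rewrite integral_g.
rewrite limeMl//; last first.
  apply: ereal_nondecreasing_is_cvgn => n k nk; apply: ge0_le_integral => //.
  - by move=> w _; rewrite lee_fin.
  - by move=> w _; exact: q_nd.
rewrite lim_q -(mean_sum_len2 mF taubar_gt0 mS0 msig S0_ge0 sig_ge0 sigF S0F
  iS iStau iTtau taubarE t0).
rewrite muleA -EFinM divfK ?gt_eqF//; congr (_ * _)%E.
have ge0 i : (0 <= \int[P]_w (len S0 sig t i w ^+ 2)%:E)%E.
  by apply: integral_ge0 => w _; rewrite lee_fin sqr_ge0.
rewrite (nneseries_split 0 1)//= add0n big_nat1.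
congr (_ + _)%E.
  by apply: eq_integral => w _; rewrite len0.
rewrite -(nneseries_addn 1)//.
apply: eq_eseriesr => i _; apply: eq_integral => w _.
by rewrite addn1 lenS.
Qed.

End mean_square_displacement.

(** * The main term and the remainder *)

Section kernel.
Context (R : realType).
Local Notation lam := (@lebesgue_measure R).
Implicit Types t s : R.

Lemma kern_ge0 t s : 0 <= t -> 0 <= s -> 0 <= kern t s.
Proof. by move=> t0 s0; rewrite /kern; case: ifPn; nra. Qed.

Lemma kern_le_sqr t s : kern t s <= t ^+ 2.
Proof.
by rewrite /kern; case: ifPn => // _; have := sqr_ge0 (t - s); rewrite sqrrB; lra.
Qed.

Lemma kern_le_mul t s : 0 <= t -> kern t s <= 2 * t * s.
Proof.
move=> t0; rewrite /kern; case: ifPn => [_|]; first by rewrite gerBl sqr_ge0.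
by rewrite -ltNge; nra.
Qed.

Lemma measurable_kern t : measurable_fun setT (kern t).
Proof.
apply: measurable_fun_ifT => //.
- exact: measurable_fun_ler.
- by apply: measurable_funB; [exact: measurable_funM|exact: measurable_funX].
Qed.

Lemma integrable_kern (f : R -> R) t : 0 <= t ->
  lam.-integrable `]0, +oo[ (EFin \o f) ->
  lam.-integrable `]0, +oo[ (EFin \o (fun s => f s * kern t s)).
Proof.
move=> t0 intf.
apply: (@le_integrable _ _ _ lam _ _ _ (EFin \o (fun s => t ^+ 2 * f s))) => //.
- apply/measurable_EFinP; apply: measurable_funM.
    by apply/measurable_EFinP; exact: measurable_int intf.
  by apply: measurable_funTS; exact: measurable_kern.
- move=> s; rewrite /= in_itv/= andbT => s0; rewrite lee_fin.
  rewrite (normrM (f s)) (normrM (t ^+ 2)) mulrC ler_wpM2r//.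
  by rewrite !ger0_norm ?sqr_ge0 ?kern_ge0 ?(ltW s0)// kern_le_sqr.
- by apply: eq_integrable (integrableZl _ (t ^+ 2) intf).
Qed.

Lemma Rintegral_kern (f : R -> R) t : 0 < t ->
  lam.-integrable `]0, +oo[ (EFin \o f) ->
  Rintegral lam `]0, +oo[ (fun s => f s * kern t s) =
  t ^+ 2 * Rintegral lam `[t, +oo[ f +
  Rintegral lam `]0, t] (fun u => f u * (2 * t * u - u ^+ 2)).
Proof.
move=> t0 intf; have intfk := integrable_kern (ltW t0) intf.
have E : `]0, +oo[%classic = `]0, t] `|` `]t, +oo[ :> set R.
  by rewrite -itv_bndbnd_setU// bnd_simp// ltW.
have sub : `]t, +oo[%classic `<=` (`]0, +oo[%classic : set R).
  by move=> s; rewrite /= !in_itv/= !andbT; exact: lt_trans.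
rewrite E Rintegral_setU//; last 2 first.
- by rewrite -E.
- by apply/disj_setPS => s [/=]; rewrite !in_itv/= andbT => /andP[_]; case: ltP.
rewrite addrC; congr (_ + _).
  have inttf : lam.-integrable `]t, +oo[ (EFin \o f).
    by apply: (integrableS _ _ _ intf).
  rewrite -Rintegral_itv_obnd_cbnd// -RintegralZl//.
  apply: eq_Rintegral => s; rewrite inE/= in_itv/= andbT => ts.
  by rewrite /kern leNgt ts mulrC.
apply: eq_Rintegral => s; rewrite inE/= in_itv/= => /andP[_ st].
by rewrite /kern st.
Qed.

Lemma normr_Rintegral_kern (f : R -> R) t : 0 <= t ->
  lam.-integrable `]0, +oo[ (EFin \o f) ->
  lam.-integrable `]0, +oo[ (EFin \o (fun s => f s * s)) ->
  `|Rintegral lam `]0, +oo[ (fun s => f s * kern t s)| <=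
  2 * t * Rintegral lam `]0, +oo[ (fun s => `|f s * s|).
Proof.
move=> t0 intf intfs; have intfk := integrable_kern t0 intf.
apply: (le_trans (le_normr_Rintegral _ intfk)) => //.
rewrite -RintegralZl//; last exact: integrable_norm.
apply: le_Rintegral => //.
- exact: integrable_norm.
- have ifs : lam.-integrable `]0, +oo[ (EFin \o (fun s => `|f s * s|)).
    exact: integrable_norm.
  by apply: eq_integrable (integrableZl _ (2 * t) ifs).
move=> s; rewrite /= in_itv/= andbT => s0.
rewrite !normrM mulrCA ler_wpM2l// ger0_norm ?kern_ge0 ?(ltW s0)// gtr0_norm//.
exact: kern_le_mul.
Qed.

End kernel.

Theorem theorem7p2 (R : realType) (F G H : R -> R) (v2 : R) (d : nat)
  (dT : measure_display) (T : measurableType dT) (P : probability T R)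
  (T0 : T -> R) (tau : nat -> T -> R) (V : nat -> T -> d.-tuple R) :
  (* F: continuous distribution function of a positive r.v. with finite mean *)
  continuous F ->
  F 0 = 0 ->
  (@lebesgue_measure R).-integrable `[0, +oo[ (fun s => (1 - F s)%:E) ->
  let taubar := Rintegral (@lebesgue_measure R) `[0, +oo[ (fun s => 1 - F s) in
  (* the random variables *)
  measurable_fun setT T0 ->
  (forall i, measurable_fun setT (tau i)) ->
  (forall i, measurable_fun setT (V i)) ->
  (* tau_1, tau_2, ... have distribution F *)
  (forall i t, P (tau i @^-1` `]-oo, t]) = (F t)%:E) ->
  (* T_0 has distribution F_0 *)
  (forall t, P (T0 @^-1` `]-oo, t]) =
     (taubar^-1 * Rintegral (@lebesgue_measure R) `[0, t] (fun s => 1 - F s))%:E) ->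
  (* the V_i are identically distributed *)
  (forall i (B : set (d.-tuple R)), measurable B ->
     P (V i @^-1` B) = P (V 0 @^-1` B)) ->
  (* T_0, tau_1, tau_2, ..., V_0, V_1, ... are mutually independent *)
  mutually_independent P (fun k : eq_index => match k with
                            | None => gen_events T0
                            | Some (inl n) => gen_events (tau n)
                            | Some (inr n) => gen_events (V n) end) ->
  (* E[V_i] = 0 and E|V_i|^2 = v^2 in (0, oo) *)
  (forall i (j : 'I_d), P.-integrable setT (fun w => (tnth (V i w) j)%:E) /\
     (\int[P]_w (tnth (V i w) j)%:E)%E = 0%E) ->
  0 < v2 ->
  (forall i, (\int[P]_w (\sum_(j < d) (tnth (V i w) j) ^+ 2)%:E)%E = v2%:E) ->
  (* decomposition 1 - F = G + H on (0, oo) *)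
  (forall t, 0 < t -> 1 - F t = G t + H t) ->
  (@lebesgue_measure R).-integrable `]0, +oo[ (fun t => (G t)%:E) ->
  (@lebesgue_measure R).-integrable `]0, +oo[ (fun t => (H t)%:E) ->
  (@lebesgue_measure R).-integrable `]0, +oo[ (fun t => (H t * t)%:E) ->
  (* conclusion: M_eq(t) = v^2/taubar (...) + O(t) as t -> oo *)
  exists C : R, exists t0 : R, forall t : R, t0 <= t ->
    msd P T0 tau V t \is a fin_num /\
    `| fine (msd P T0 tau V t)
       - v2 / taubar *
         (t ^+ 2 * Rintegral (@lebesgue_measure R) `[t, +oo[ G
          + Rintegral (@lebesgue_measure R) `]0, t]
              (fun u => G u * (2 * t * u - u ^+ 2))) | <= C * t.
Proof.
move=> cF F0 iF taubar mT0 mtau mV tauF T0F _ ind iV v2_gt0 V2 GH iG iH iHt.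
have mF : measurable_fun setT F by exact: continuous_measurable_fun.
have D_ge0 x : 0 <= 1 - F x by exact: (tail_ge0 mtau tauF).
have taubarE : (\int[@lebesgue_measure R]_(u in `[0%R, +oo[) (1 - F u)%:E = taubar%:E)%E.
  by rewrite /taubar /Rintegral fineK// (integrable_fin_num _ iF).
have taubar_gt0 : 0 < taubar.
  rewrite lt_neqAle Rintegral_ge0// andbT; apply/eqP => tb0.
  have [n] := exists_prob_le_gt0 P mT0.
  by rewrite -preim_le T0F -tb0 invr0 mul0r ltxx.
have T0F' t : P (T0 @^-1` `]-oo, t]) = ((taubar^-1)%:E *
    \int[@lebesgue_measure R]_(u in `[0%R, t]) (1 - F u)%:E)%E.
  rewrite T0F EFinM; congr (_ * _)%E; rewrite fineK//.
  apply: integrable_fin_num => //; apply: (integrableS _ _ _ iF) => //.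
  by apply: subset_itvl; rewrite bnd_simp.
pose K := Rintegral (@lebesgue_measure R) `]0, +oo[ (fun s => `|H s * s|).
exists (v2 / taubar * (2 * K)), 1 => t t1.
have t0 : 0 < t by rewrite (lt_le_trans _ t1).
have v2t0 : 0 <= v2 / taubar by rewrite divr_ge0// ltW.
rewrite (msdE mF F0 taubar_gt0 mT0 mtau mV tauF T0F' taubarE ind iV V2 (ltW t0)).
rewrite -integral_itv_obnd_cbnd; last first.
  apply/measurable_EFinP; apply: measurable_funTS.
  by apply: measurable_funM; [exact: measurable_funB|exact: measurable_kern].
have iGk := integrable_kern (ltW t0) iG.
have iHk := integrable_kern (ltW t0) iH.
have DE : {in `]0, +oo[%classic, (fun s => (1 - F s) * kern t s) =1
    (fun s => G s * kern t s + H s * kern t s)}.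
  by move=> s; rewrite inE/= in_itv/= andbT => s0; rewrite GH// mulrDl.
have iDk : (@lebesgue_measure R).-integrable `]0, +oo[
    (EFin \o (fun s => (1 - F s) * kern t s)).
  have iGHk : (@lebesgue_measure R).-integrable `]0, +oo[
      ((EFin \o (fun s => G s * kern t s)%R) \+ (EFin \o (fun s => H s * kern t s)%R))%E.
    exact: integrableD.
  by apply: eq_integrable iGHk => // s s0; rewrite /= DE.
have fDk := integrable_fin_num _ iDk.
split; first by rewrite fin_numM// fDk.
rewrite fineM//; last exact: fDk.
rewrite -(Rintegral_kern t0 iG) /=.
rewrite [X in v2 / taubar * X - _](_ : _ =
    Rintegral (@lebesgue_measure R) `]0, +oo[ (fun s => G s * kern t s) +
    Rintegral (@lebesgue_measure R) `]0, +oo[ (fun s => H s * kern t s)); last first.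
  by rewrite -RintegralD//; apply: eq_Rintegral.
rewrite -mulrBr addrAC subrr add0r normrM (ger0_norm v2t0) -[leRHS]mulrA ler_wpM2l//.
by rewrite [leRHS]mulrAC normr_Rintegral_kern// ltW.
Qed.
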